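(* Let $p$ be a prime and let $G$ be a finite potent $p$-group. Then $\exp(M(G))$ and $\exp(\mu(G))$ both divide $p\cdot \exp(G)$.
   Context: $M(G)$ denotes the Schur multiplier of $G$, which is isomorphic to the second integral homology group $H_2(G)$. Write $x^y=y^{-1}xy$. The non-abelian tensor square $G\otimes G$ is the group generated by symbols $g\otimes h$, $g,h\in G$, subject to the relations $$gg_1\otimes h=(g^{g_1}\otimes h^{g_1})(g_1\otimes h),\qquad g\otimes hh_1=(g\otimes h_1)(g^{h_1}\otimes h^{h_1})$$ for all $g,g_1,h,h_1\in G$. The group $\mu(G)$ is the kernel of the derived map $G\otimes G\to G'$, $g\otimes h\mapsto [g,h]$. For a $p$-group $H$ and an integer $m\ge 1$, $H^{m}$ denotes the subgroup generated by all $h^m$, $h \in H$; $H'=[H,H]$; $\gamma_1(H)=H$ and $\gamma_{k+1}(H)=[\gamma_k(H),H]$; $\exp(H)$ is the exponent of $H$. A finite $p$-group $H$ is potent if $p>2$ and $\gamma_{p-1}(H)\leqslant H^p$, or $p=2$ and $H'\leqslant H^4$. *)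

(* Defs.v *)
From HB Require Import structures.
From mathcomp Require Import all_boot all_order all_algebra all_fingroup.
From mathcomp Require Import all_solvable generic_quotient boolp zify.

Set Implicit Arguments.
Unset Strict Implicit.
Unset Printing Implicit Defensive.

Import GRing.Theory.

(* The exponent of a possibly infinite set of group elements: the least n > 0 *)
(* that kills every element of A, and 0 when there is none.                   *)
Section Exponent.
Local Open Scope group_scope.
Variable T : groupType.
Implicit Type A : {pred T}.

Definition annihilates A (n : nat) : bool :=
  `[< 0 < n /\ forall x, x \in A -> x ^+ n = 1 >].

Definition gexponent A : nat :=
  if pselect (exists n, annihilates A n) is left exA then ex_minn exA else 0.

Lemma gexponentP A n : 0 < n ->
  (gexponent A %| n) <-> (forall x, x \in A -> x ^+ n = 1).
Proof.
move=> n0; rewrite /gexponent; case: pselect => [exA|nex]; last first.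
  split; first by rewrite dvd0n => /eqP n00; rewrite n00 in n0.
  by move=> h; case: nex; exists n; apply/asboolP.
case: ex_minnP => m /asboolP[m0 mA] mmin; split=> [/dvdnP[k ->] x /mA xm|nA].
  by rewrite mulnC expgM xm expg1n.
rewrite /dvdn; apply/negPn/negP; rewrite -lt0n => r0.
have: m <= n %% m; last by rewrite leqNgt ltn_pmod.
apply: mmin; apply/asboolP; split=> // x xA.
have := nA x xA; rewrite {1}(divn_eq n m) expgnDr mulnC expgM.
by rewrite mA // expg1n mul1g.
Qed.

End Exponent.

(* The group presented by generators X and relations R. A word is a sequence  *)
(* of letters, (x, false) standing for x and (x, true) for its inverse.       *)
Section Presentation.
Local Open Scope quotient_scope.
Variables (X : choiceType).
Notation word := (seq (X * bool)).

Inductive pres_eq (R : word -> word -> Prop) : word -> word -> Prop :=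
  | pres_rel u v : R u v -> pres_eq R u v
  | pres_cancel x b : pres_eq R [:: (x, b); (x, ~~ b)] [::]
  | pres_refl u : pres_eq R u u
  | pres_sym u v : pres_eq R u v -> pres_eq R v u
  | pres_trans v u w : pres_eq R u v -> pres_eq R v w -> pres_eq R u w
  | pres_cat u u' v v' :
      pres_eq R u u' -> pres_eq R v v' -> pres_eq R (u ++ v) (u' ++ v').

Definition winv (w : word) : word := rev [seq (l.1, ~~ l.2) | l <- w].

Variable R : word -> word -> Prop.

Definition pres_eqb (u v : word) : bool := `[< pres_eq R u v >].

Fact pres_eqb_refl : reflexive pres_eqb.
Proof. by move=> u; apply/asboolP/pres_refl. Qed.
Fact pres_eqb_sym : symmetric pres_eqb.
Proof. by move=> u v; apply/asboolP/asboolP; apply: pres_sym. Qed.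
Fact pres_eqb_trans : transitive pres_eqb.
Proof.
by move=> v u w /asboolP uv /asboolP vw; apply/asboolP/(pres_trans uv vw).
Qed.

Canonical pres_equiv := EquivRel pres_eqb pres_eqb_refl pres_eqb_sym
  pres_eqb_trans.

Definition presented := {eq_quot pres_equiv}.
HB.instance Definition _ := Choice.on presented.
HB.instance Definition _ := EqQuotient.on presented.

Lemma pi_presentedP (u v : word) :
  \pi_presented u = \pi_presented v <-> pres_eq R u v.
Proof.
by split=> [/eqP|uv];
  [rewrite piE => /asboolP
  | apply/eqP; rewrite piE; apply/asboolP].
Qed.

Lemma repr_presentedP (u : word) : pres_eq R (repr (\pi_presented u)) u.
Proof. by apply/pi_presentedP; rewrite reprK. Qed.

Lemma winv_cat u v : winv (u ++ v) = winv v ++ winv u.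
Proof. by rewrite /winv map_cat rev_cat. Qed.

Lemma winvK : involutive winv.
Proof.
move=> u; rewrite /winv map_rev revK -map_comp -[RHS]map_id.
by apply: eq_map => -[x b] /=; rewrite negbK.
Qed.

Lemma winv_catr u : pres_eq R (u ++ winv u) [::].
Proof.
elim: u => [|[x b] u IHu]; first exact: pres_refl.
rewrite -cat1s winv_cat -catA [u ++ _]catA.
apply: pres_trans (pres_cancel R x b).
apply: (@pres_cat _ [:: _] [:: _] _ [:: _]); first exact: pres_refl.
exact: (pres_cat IHu (pres_refl R [:: (x, ~~ b)])).
Qed.

Lemma winv_catl u : pres_eq R (winv u ++ u) [::].
Proof. by rewrite -{2}[u]winvK; apply: winv_catr. Qed.

Lemma pres_winv u v : pres_eq R u v -> pres_eq R (winv u) (winv v).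
Proof.
move=> uv; rewrite -[winv u]cats0.
apply: (pres_trans (pres_cat (pres_refl R _) (pres_sym (winv_catr v)))).
rewrite catA -[X in pres_eq R _ X]cat0s.
apply: pres_cat (pres_refl R _); apply: pres_trans (winv_catl u).
exact: pres_cat (pres_refl R _) (pres_sym uv).
Qed.

Definition pres_mul (a b : presented) : presented :=
  \pi_presented (repr a ++ repr b).
Definition pres_inv (a : presented) : presented :=
  \pi_presented (winv (repr a)).
Definition pres_one : presented := \pi_presented [::].

Lemma pi_pres_mul u v :
  pres_mul (\pi_presented u) (\pi_presented v) = \pi_presented (u ++ v).
Proof.
exact/pi_presentedP/(pres_cat (repr_presentedP u) (repr_presentedP v)).
Qed.

Lemma pi_pres_inv u : pres_inv (\pi_presented u) = \pi_presented (winv u).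
Proof. by apply/pi_presentedP; apply: pres_winv (repr_presentedP u). Qed.

Fact pres_mulA : associative pres_mul.
Proof.
move=> a b c; elim/quotW: a => u; elim/quotW: b => v; elim/quotW: c => w.
by rewrite (pi_pres_mul v) (pi_pres_mul u v) (pi_pres_mul u)
  (pi_pres_mul (u ++ v)) catA.
Qed.
Fact pres_mul1 : left_id pres_one pres_mul.
Proof. by move=> a; elim/quotW: a => u; rewrite (pi_pres_mul [::]). Qed.
Fact pres_mulr1 : right_id pres_one pres_mul.
Proof. by move=> a; elim/quotW: a => u; rewrite (pi_pres_mul u [::]) cats0. Qed.
Fact pres_mulV : left_inverse pres_one pres_inv pres_mul.
Proof.
move=> a; elim/quotW: a => u; rewrite (pi_pres_inv u) (pi_pres_mul _ u).
exact/pi_presentedP/winv_catl.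
Qed.
Fact pres_mulrV : right_inverse pres_one pres_inv pres_mul.
Proof.
move=> a; elim/quotW: a => u; rewrite (pi_pres_inv u) (pi_pres_mul u).
exact/pi_presentedP/winv_catr.
Qed.

HB.instance Definition _ := isGroup.Build presented
  pres_mulA pres_mul1 pres_mulr1 pres_mulV pres_mulrV.

Definition pres_gen (x : X) : presented := \pi_presented [:: (x, false)].

Section Lift.
Local Open Scope group_scope.
Variables (T : groupType) (f : X -> T).

Definition eval_word (w : word) : T :=
  \prod_(l <- w) (if l.2 then (f l.1)^-1 else f l.1).

Definition pres_lift (a : presented) : T := eval_word (repr a).

Hypothesis fR : forall u v, R u v -> eval_word u = eval_word v.

Lemma eval_pres_eq u v : pres_eq R u v -> eval_word u = eval_word v.
Proof.
elim=> {u v} [u v /fR //|x b|//|u v _ -> //|v u w _ -> _ -> //|].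
  rewrite /eval_word !big_cons !big_nil mulg1.
  by case: b => /=; rewrite ?mulVg ?mulgV.
move=> u u' v v' _ uu' _ vv'.
by rewrite /eval_word !big_cat /= -!/(eval_word _) uu' vv'.
Qed.

Lemma pres_lift_pi u : pres_lift (\pi_presented u) = eval_word u.
Proof. exact/eval_pres_eq/repr_presentedP. Qed.

Lemma pres_liftM : {morph pres_lift : a b / a * b}.
Proof.
move=> a b; elim/quotW: a => u; elim/quotW: b => v.
by rewrite [_ * _]pi_pres_mul !pres_lift_pi /eval_word big_cat.
Qed.

Lemma pres_lift_gen x : pres_lift (pres_gen x) = f x.
Proof. by rewrite pres_lift_pi /eval_word big_seq1. Qed.

End Lift.

End Presentation.

Section TensorSquare.
Local Open Scope group_scope.
Variable gT : finGroupType.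
Notation tsr g h := (((g, h), false) : (gT * gT) * bool).

Inductive tensor_rel :
  seq ((gT * gT) * bool) -> seq ((gT * gT) * bool) -> Prop :=
  | tensor_relL g g1 h :
      tensor_rel [:: tsr (g * g1) h] [:: tsr (g ^ g1) (h ^ g1); tsr g1 h]
  | tensor_relR g h h1 :
      tensor_rel [:: tsr g (h * h1)] [:: tsr g h1; tsr (g ^ h1) (h ^ h1)].

Definition tensor_square := presented tensor_rel.
HB.instance Definition _ := monoid.Group.on tensor_square.

Definition tensor (g h : gT) : tensor_square := pres_gen tensor_rel (g, h).

Definition derived_map : tensor_square -> gT :=
  pres_lift (fun gh : gT * gT => [~ gh.1, gh.2]).

Fact derived_map_rel u v : tensor_rel u v ->
  eval_word (fun gh : gT * gT => [~ gh.1, gh.2]) u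
  = eval_word (fun gh : gT * gT => [~ gh.1, gh.2]) v.
Proof.
by case=> [g g1 h|g h h1]; rewrite /eval_word !big_cons !big_nil /= !mulg1;
  rewrite -conjRg (commMgJ, commgMJ).
Qed.

HB.instance Definition _ := isMultiplicative.Build
  tensor_square gT derived_map (pres_liftM derived_map_rel).

Lemma derived_map_tensor g h : derived_map (tensor g h) = [~ g, h].
Proof. exact: (pres_lift_gen derived_map_rel). Qed.

Definition mu : {pred tensor_square} := [pred t | derived_map t == 1].

End TensorSquare.

Arguments mu gT : clear implicits.

(* ker f / im g *)
Section Homology.
Local Open Scope ring_scope.
Local Open Scope quotient_scope.
Variables (U V W : zmodType) (g : {additive U -> V}) (f : {additive V -> W}).

Definition is_cycle : {pred V} := [pred z | f z == 0].

Fact is_cycle_zmod : zmod_closed is_cycle.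
Proof.
split=> [|x y]; first by rewrite inE raddf0.
by rewrite !inE raddfB => /eqP-> /eqP->; rewrite subr0.
Qed.
HB.instance Definition _ := GRing.isZmodClosed.Build V is_cycle is_cycle_zmod.

Record cycle := Cycle { cycle_val :> V; cycleP : cycle_val \in is_cycle }.
HB.instance Definition _ := [isSub for cycle_val].
HB.instance Definition _ := [Choice of cycle by <:].
HB.instance Definition _ := [SubChoice_isSubZmodule of cycle by <:].

Definition homologous (x y : cycle) : bool :=
  `[< exists c, val x - val y = g c >].

Fact homologous_refl : reflexive homologous.
Proof. by move=> x; apply/asboolP; exists 0; rewrite subrr raddf0. Qed.
Fact homologous_sym : symmetric homologous.
Proof.
by move=> x y; apply/asboolP/asboolP=> -[c xy];
  exists (- c); rewrite raddfN -xy opprB.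
Qed.
Fact homologous_trans : transitive homologous.
Proof.
move=> y x z /asboolP[c xy] /asboolP[d yz]; apply/asboolP; exists (c + d).
by rewrite raddfD -xy -yz addrA subrK.
Qed.

Canonical homologous_equiv := EquivRel homologous homologous_refl
  homologous_sym homologous_trans.

Definition homology := {eq_quot homologous_equiv}.
HB.instance Definition _ := Choice.on homology.
HB.instance Definition _ := EqQuotient.on homology.

Lemma pi_homologyP (x y : cycle) :
  \pi_homology x = \pi_homology y <-> exists c, val x - val y = g c.
Proof.
by split=> [/eqP|xy];
  [rewrite piE => /asboolP
  | apply/eqP; rewrite piE; apply/asboolP].
Qed.

Lemma repr_homologyP (x : cycle) :
  exists c, val (repr (\pi_homology x)) - val x = g c.
Proof. by apply/pi_homologyP; rewrite reprK. Qed.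

Definition homology_add (a b : homology) : homology :=
  \pi_homology (repr a + repr b).
Definition homology_opp (a : homology) : homology := \pi_homology (- repr a).
Definition homology_zero : homology := \pi_homology 0.

Lemma pi_homology_add x y :
  homology_add (\pi_homology x) (\pi_homology y) = \pi_homology (x + y).
Proof.
apply/pi_homologyP; have [[c xc] [d yd]] := (repr_homologyP x, repr_homologyP y).
by exists (c + d); rewrite !raddfD /= -xc -yd addrACA.
Qed.

Lemma pi_homology_opp x : homology_opp (\pi_homology x) = \pi_homology (- x).
Proof.
apply/pi_homologyP; have [c xc] := repr_homologyP x.
by exists (- c); rewrite (raddfN g) -xc -!raddfB raddfN.
Qed.

Fact homology_addA : associative homology_add.
Proof.
by move=> a b c; elim/quotW: a => x; elim/quotW: b => y; elim/quotW: c => z;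
  rewrite (pi_homology_add y) (pi_homology_add x y) (pi_homology_add x)
    (pi_homology_add (x + y)) addrA.
Qed.
Fact homology_addC : commutative homology_add.
Proof.
by move=> a b; elim/quotW: a => x; elim/quotW: b => y; rewrite (pi_homology_add x) (pi_homology_add y) addrC.
Qed.
Fact homology_add0 : left_id homology_zero homology_add.
Proof. by move=> a; elim/quotW: a => x; rewrite (pi_homology_add 0) add0r. Qed.
Fact homology_addN : left_inverse homology_zero homology_opp homology_add.
Proof.
by move=> a; elim/quotW: a => x; rewrite (pi_homology_opp x) (pi_homology_add _ x) addNr.
Qed.

HB.instance Definition _ := GRing.isZmodule.Build homology
  homology_addA homology_addC homology_add0 homology_addN.

End Homology.

(* The free abelian group on a finite type X is {ffun X -> int}.              *)
Section FreeAbelian.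
Local Open Scope ring_scope.
Variables (X Y : finType).

Definition basis (x : X) : {ffun X -> int} := [ffun y => (y == x)%:Z].

Definition ext (b : X -> {ffun Y -> int}) (c : {ffun X -> int}) :
  {ffun Y -> int} := \sum_x b x *~ c x.

Fact ext_is_additive b : zmod_morphism (ext b).
Proof.
move=> c d; rewrite /ext -sumrB; apply: eq_bigr => x _.
by rewrite !ffunE mulrzBr.
Qed.
HB.instance Definition _ b :=
  GRing.isZmodMorphism.Build _ _ (ext b) (ext_is_additive b).

Lemma ext_basis b x : ext b (basis x) = b x.
Proof.
rewrite /ext (bigD1 x) //= ffunE eqxx big1 ?addr0 // => y /negPf yx.
by rewrite ffunE yx.
Qed.

End FreeAbelian.

(* The (inhomogeneous) bar complex of a group, with trivial coefficients Z,   *)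
(* in degrees 3 -> 2 -> 1.                                                    *)
Section SchurMultiplier.
Variable gT : finGroupType.
Local Open Scope ring_scope.

Definition bar2 : {ffun gT * gT -> int} -> {ffun gT -> int} :=
  ext (fun gh => basis gh.2 - basis (gh.1 * gh.2)%g + basis gh.1).

Definition bar3 : {ffun gT * gT * gT -> int} -> {ffun gT * gT -> int} :=
  ext (fun ghk => let: (g, h, k) := ghk in
    basis (h, k) - basis ((g * h)%g, k) + basis (g, (h * k)%g) - basis (g, h)).

HB.instance Definition _ := GRing.Additive.on bar2.
HB.instance Definition _ := GRing.Additive.on bar3.

Lemma bar2_bar3 c : bar2 (bar3 c) = 0.
Proof.
rewrite /bar3 /ext raddf_sum big1 // => -[[g h] k] _; rewrite raddfMz.
rewrite !(raddfB, raddfD) /= /bar2 !ext_basis /= mulgA.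
set a := basis g; set b := basis h; set d := basis k.
set u := basis (g * h)%g; set v := basis (h * k)%g; set w := basis _.
suff -> : (d - v + b - (d - w + u) + (v - w + a) - (b - u + a))%R = 0.
  by rewrite mul0rz.
by apply/ffunP=> x; rewrite !ffunE; lia.
Qed.

(* H_2(G, Z), written multiplicatively.                                       *)
Definition schur_multiplier := Algebra.to_multiplicative (homology bar3 bar2).
HB.instance Definition _ := monoid.Group.on schur_multiplier.

End SchurMultiplier.

Section Potent.
Local Open Scope group_scope.
Variable gT : finGroupType.

Definition power_subgroup (m : nat) (H : {set gT}) : {set gT} :=
  <<[set h ^+ m | h in H]>>.

Definition potent (p : nat) (H : {set gT}) : bool :=
  p.-group H &&
  (((2 < p) && ('L_p.-1(H) \subset power_subgroup p H))
   || ((p == 2) && (H^`(1) \subset power_subgroup 4 H))).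

End Potent.

(* Main.v *)
Require Import Defs.
From HB Require Import structures.
From mathcomp Require Import all_boot all_order all_algebra all_fingroup.
From mathcomp Require Import all_solvable generic_quotient boolp zify.

(* In fact every element of T = G (x) G is killed by exp(G). Let W be a finite
   p-group containing T as a normal subgroup, on which W acts through G. The
   element y^p (x) h agrees with (y (x) h)^p modulo the error term of Hall's
   formula (xu)^p = x^p u^p, and potency of G forces this error term, for each
   member P of the iterated power series of T, into Mho(Mho P) [Mho P, W]. By a
   Nakayama argument the i-th iterated power subgroup of T is then generated by
   the elements g^(p^i) (x) h, which are trivial once p^i = exp(G).
   The group T is finite by Dietzmann's lemma, because its generators have
   finite order by descending induction along the lower central series of G.
   Finally the universal 2-cocycle gives a central extension E of G by
   coker(C_3 -> C_2); the map g (x) h |-> [e_g, e_h] sends T onto E', which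
   contains H_2(G), so exp(G) kills H_2(G) as well. *)

Set Implicit Arguments.
Unset Strict Implicit.
Unset Printing Implicit Defensive.

Local Open Scope group_scope.

(** * Polynomial sequences in filtered groups *)

Section GroupIdentities.
Variable G : groupType.
Implicit Types x y z : G.

Lemma commMg_conj x y z : [~ x * y, z] = [~ x, z] ^ y * [~ y, z].
Proof. by rewrite !commgEr conjgM mulgA -conjMg mulgK. Qed.

Lemma commgM_conj x y z : [~ x, y * z] = [~ x, z] * [~ x, y] ^ z.
Proof. by rewrite !commgEl conjgM -mulgA -conjMg mulKVg. Qed.

End GroupIdentities.

Section PolynomialSequences.
Implicit Type G : groupType.

Record filtration G (F : nat -> G -> Prop) : Prop := Filtration {
  filt1 : forall i, F i 1;
  filtM : forall i x y, F i x -> F i y -> F i (x * y);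
  filtV : forall i x, F i x -> F i x^-1;
  filtS : forall i x, F i.+1 x -> F i x;
  filtR : forall i j x y, F i x -> F j y -> F (i + j) [~ x, y]
}.

(** The degree-i term of the group of edges (1-dimensional Host-Kra cubes) over F; iterating it
    produces cubes of higher dimension. *)
Definition cube_filt G (F : nat -> G -> Prop) i (u : (G * G)%type) : Prop :=
  F i u.1 /\ F i.+1 (u.1^-1 * u.2).

Lemma filt_le G (F : nat -> G -> Prop) i j x :
  filtration F -> i <= j -> F j x -> F i x.
Proof. by move=> FF /subnK <-; elim: (j - i) => // k IHk /(filtS FF)/IHk. Qed.

Lemma filtJ G (F : nat -> G -> Prop) i x y :
  filtration F -> F i x -> F 0 y -> F i (x ^ y).
Proof.
move=> FF Fx Fy; have -> : x ^ y = x * [~ x, y] by rewrite commgEl mulKVg.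
by apply: (filtM FF) => //; rewrite -[i]addn0; apply: (filtR FF).
Qed.

Lemma cube_filtration G (F : nat -> G -> Prop) :
  filtration F -> filtration (cube_filt F).
Proof.
move=> FF; have F0 i x : F i x -> F 0 x by apply: filt_le.
split=> [i|i [x x'] [y y'] [/= Fx Fx'] [/= Fy Fy']|i [x x'] [/= Fx Fx']
        |i [x x'] [/= Fx Fx']|i j [x x'] [y y'] [/= Fx Fx'] [/= Fy Fy']].
- by split=> /=; rewrite ?mulVg; apply: (filt1 FF).
- split=> /=; first exact: (filtM FF).
  have -> : (x * y)^-1 * (x' * y') = (x^-1 * x') ^ y * (y^-1 * y').
    by rewrite conjgE invMg !mulgA mulgK.
  by apply: (filtM FF) => //; apply: filtJ (F0 _ _ Fy).
- split=> /=; first exact: (filtV FF).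
  have -> : x^-1^-1 * x'^-1 = (x^-1 * x')^-1 ^ x^-1.
    by rewrite conjgE !invMg !invgK !mulgA mulgK.
  by apply: (filtJ FF); [apply: (filtV FF) | apply/(filtV FF)/F0/Fx].
- by split=> /=; apply: (filtS FF).
set a := x^-1 * x' in Fx'; have -> : x' = x * a by rewrite mulKVg.
set b := y^-1 * y' in Fy'; have -> : y' = y * b by rewrite mulKVg.
clearbody a b; split=> /=; first exact: (filtR FF).
have FR : F (i + j) [~ x, y] by apply: (filtR FF).
(* Each of the three commutators gains one degree over i + j: from b, from the entry a b of degree
   1, and from a. *)
have -> : [~ x, y]^-1 * [~ x * a, y * b] =
    [~ x * a, b] ^ [~ x, y] * [~ [~ x, y], a * b] * [~ a, y] ^ b.
  rewrite commgM_conj (commMg_conj x a y) conjMg -conjgM.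
  rewrite [[~ [~ x, y], _]]commgEl.
  move: [~ x * a, b] [~ x, y] ([~ a, y] ^ b) => u q v.
  by move: (q ^ (a * b)) => w; rewrite conjgE !mulgA mulgK.
apply: (filtM FF); first apply: (filtM FF).
- apply: (filtJ FF); last exact: F0 FR.
  rewrite -addnS; apply: (filtR FF) => //; apply: (filtM FF) => //.
  exact: (filtS FF).
- rewrite -addn1; apply: (filtR FF) => //.
  by apply: (filtM FF); [apply: (filt_le FF _ Fx') | apply: (filt_le FF _ Fy')].
by apply: (filtJ FF); [rewrite -addSn; apply: (filtR FF) | apply: F0 Fy'].
Qed.

(* The discrete cubes of dimension at most k spanned by f are compatible with
   F. As such cubes form a group, products of polynomial sequences are again
   polynomial (the Lazard-Leibman theorem). *)
Fixpoint poly_upto k G (F : nat -> G -> Prop) (f : nat -> G) : Prop :=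
  if k is k'.+1 then
    poly_upto k' (cube_filt F) (fun n => (f n, f n.+1) : (G * G)%type)
  else forall n, F 0 (f n).

Lemma poly_uptoM k G (F : nat -> G -> Prop) f g : filtration F ->
  poly_upto k F f -> poly_upto k F g -> poly_upto k F (fun n => f n * g n).
Proof.
elim: k G F f g => [|k IHk] G F f g FF /= Pf Pg.
  by move=> n; apply: (filtM FF).
exact: IHk (cube_filtration FF) Pf Pg.
Qed.

(** Pascal's rule writes the edge (x^C(n,i+1), x^C(n+1,i+1)) as (x,x)^C(n,i+1) (1,x)^C(n,i), where
    (1,x) has cube degree i if x has degree i + 1. *)
Lemma poly_upto_bin k G (F : nat -> G -> Prop) i x : filtration F ->
  F i x -> poly_upto k F (fun n => x ^+ 'C(n, i)).
Proof.
elim: k G F i x => [|k IHk] G F i x FF Fx /=.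
  move=> n; apply: (filt_le FF (leq0n i)).
  by elim: 'C(n, i) => [|m IHm]; rewrite ?expg0 ?expgS;
    [apply: (filt1 FF) | apply: (filtM FF)].
have FF' := cube_filtration FF.
have pairX (a b : G) m : ((a, b) : (G * G)%type) ^+ m = (a ^+ m, b ^+ m).
  by elim: m => // m IHm; rewrite !expgS IHm.
have Pxx : poly_upto k (cube_filt F)
    (fun n => ((x, x) : (G * G)%type) ^+ 'C(n, i)).
  by apply: IHk => //; split=> //=; rewrite mulVg; apply: (filt1 FF).
case: i Fx Pxx => [|i] Fx Pxx.
  rewrite (_ : (fun _ => _) = fun n => ((x, x) : (G * G)%type) ^+ 'C(n, 0)) //.
  by apply: funext => n; rewrite pairX !bin0.
have P1x : poly_upto k (cube_filt F)
    (fun n => ((1, x) : (G * G)%type) ^+ 'C(n, i)).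
  by apply: IHk => //; split; rewrite /= ?invg1 ?mul1g //; apply: (filt1 FF).
rewrite (_ : (fun _ => _) = fun n => ((x, x) : (G * G)%type) ^+ 'C(n, i.+1) *
  ((1, x) : (G * G)%type) ^+ 'C(n, i)); first exact: poly_uptoM.
apply: funext => n; rewrite !pairX binS expgnDr expg1n.
by congr (_, _); rewrite /= mulg1.
Qed.

(** A k-cube that is trivial off its top corner has that corner in degree k; passing to edges lowers
    k by one and keeps the initial values trivial. *)
Lemma poly_upto_first k G (F : nat -> G -> Prop) f : filtration F ->
  poly_upto k F f -> (forall m, m < k -> f m = 1) -> F k (f k).
Proof.
elim: k G F f => [|k IHk] G F f FF /= Pf f1; first exact: Pf.
have [m lt_mk|_] := IHk _ _ _ (cube_filtration FF) Pf.
  by rewrite !f1 // (leq_trans lt_mk).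
by rewrite /= f1 // invg1 mul1g.
Qed.

End PolynomialSequences.

Lemma lcn_comm (gT : finGroupType) (G : {group gT}) i j :
  [~: 'L_i(G), 'L_j(G)] \subset 'L_(i + j)(G).
Proof.
case: i => [|i]; first by rewrite add0n commg_subr; apply: lcn_norm.
case: j => [|j]; first by rewrite addn0 commg_subl; apply: lcn_norm.
elim: j i => [|j IHj] i; first by rewrite lcn1 addn1 lcnSn.
rewrite commGC [in 'L_j.+2(G)]lcnSn.
pose N := [group of 'L_(i.+1 + j.+2)(G)].
have nN (A : {set gT}) : A \subset G -> A \subset 'N(N).
  by move=> sAG; apply: (subset_trans sAG); apply: lcn_norm.
have nL k : 'L_k(G) \subset 'N(N) by apply/nN/lcn_sub.
have sL k := lcn_sub k G.
have sR (A B : {set gT}) : A \subset G -> B \subset G -> [~: A, B] \subset G.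
  by move=> sA sB; apply: comm_subG.
rewrite -quotient_sub1 ?nN ?sR // !quotientR ?nN ?sR //.
apply/trivgP/three_subgroup; apply/trivgP; rewrite /= -2?quotientR ?nN ?sR //.
  rewrite quotient_sub1 ?nN ?sR // (commGC G) -lcnSn.
  by apply: subset_trans (IHj i.+1) _; rewrite !addSn !addnS.
rewrite quotient_sub1 ?nN ?sR //.
apply: subset_trans (commSg _ (IHj i)) _.
by rewrite addSn addnS -lcnSn !addSn !addnS.
Qed.

(** * Hall's power formula *)

Section HallFormula.
Variable gT : finGroupType.
Implicit Types (x y : gT) (G H K M N W : {group gT}).

Lemma lcn_filtration G : filtration (fun i x => x \in 'L_i(G)).
Proof.
split=> [i|i x y|i x|i x|i j x y]; rewrite ?group1 ?groupV //.
- exact: groupM.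
- exact/subsetP/lcn_subS.
by move=> Lx Ly; apply: (subsetP (lcn_comm G i j)); apply: mem_commg.
Qed.

(** Taylor coefficients are stripped off in turn: the factor f(j)^(-C(n,j)) trivialises the value at
    j. At n = p it lies in M since p divides C(p,j) for 2 <= j < p; what finally remains lies in
    ['L_p(G)]. *)
Lemma poly_prime_mem p G M (f : nat -> gT) : prime p ->
    (forall k, poly_upto k (fun i x => x \in 'L_i(G)) f) ->
    f 0 = 1 -> f 1%N = 1 -> (forall x, x \in 'L_2(G) -> x ^+ p \in M) ->
  'L_p(G) \subset M -> f p \in M.
Proof.
move=> p_pr Pf f0 f1 MX sLM; have FF := lcn_filtration G.
suff IH k j h : (forall k, poly_upto k (fun i x => x \in 'L_i(G)) h) ->
    2 <= j -> j + k = p -> (forall m, m < j -> h m = 1) -> h p \in M.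
  apply: (IH (p - 2) 2) => //; first by rewrite subnKC ?prime_gt1.
  by case=> [|[|]].
elim: k j h {f Pf f0 f1} => [|k IHk] j f Pf j2 def_p f1.
  rewrite addn0 in def_p; rewrite -{}def_p in sLM *.
  by apply: (subsetP sLM); apply: (poly_upto_first FF (Pf j)).
have Lg := poly_upto_first FF (Pf j) f1.
have LgV : (f j)^-1 \in 'L_j(G) by rewrite groupV.
have Ph k' := poly_uptoM FF (Pf k') (poly_upto_bin k' FF LgV).
have := IHk j.+1 _ Ph (leqW j2); rewrite addSnnS => /(_ def_p) Mh.
rewrite -(groupMr _ (_ : (f j)^-1 ^+ 'C(p, j) \in M)).
  apply: Mh => m; rewrite ltnS leq_eqVlt => /predU1P[->|lt_mj].
    by rewrite binn mulgV.
  by rewrite f1 // bin_small // mulg1.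
have /dvdnP[q ->] : p %| 'C(p, j).
  by rewrite prime_dvd_bin // (leq_trans _ j2) //= -def_p -addn1 leq_add2l.
rewrite mulnC expgnA groupX // MX // (subsetP (lcn_sub_leq _ j2)) //.
Qed.

(** The sequence y^-n x^-n (x y)^n is a product of polynomial sequences, trivial at n = 0 and n = 1,
    so [poly_prime_mem] applies. *)
Lemma hall_formula p x y (M : {group gT}) (L := <<[set x; y]>>) : prime p ->
    (forall z, z \in 'L_2(L) -> z ^+ p \in M) -> 'L_p(L) \subset M ->
  y ^- p * x ^- p * (x * y) ^+ p \in M.
Proof.
move=> p_pr MX sLM; have FF := lcn_filtration [group of L].
have [Lx Ly] : x \in L /\ y \in L by rewrite !mem_gen ?inE ?eqxx ?orbT.
have Px z k : z \in L ->
    poly_upto k (fun i x => x \in 'L_i(L)) (fun n => z ^+ n).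
  move=> Lz; rewrite (_ : (fun n => _) = fun n => z ^+ 'C(n, 1)).
    exact: (poly_upto_bin k FF).
  by apply: funext => n; rewrite bin1.
have := @poly_prime_mem p [group of L] M
  (fun n => y^-1 ^+ n * x^-1 ^+ n * (x * y) ^+ n) p_pr.
rewrite !expVgn; apply=> //.
- move=> k; apply: (poly_uptoM FF _ (Px _ _ _)); last by rewrite groupM.
  by apply: (poly_uptoM FF (Px _ _ _) (Px _ _ _)); rewrite groupV.
- by rewrite !expg0 invg1 !mulg1.
by rewrite !expg1 -invMg mulVg.
Qed.

Definition rcomm k N W : {group gT} :=
  iter k (fun A : {group gT} => [~: A, W]%G) N.

Lemma rcomm_normal k N W : N <| W -> rcomm k N W <| W.
Proof.
move=> nNW; elim: k => //= k /andP[sKW nKW].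
rewrite /normal commg_normr andbT.
by apply: comm_subG.
Qed.

Lemma rcomm_sub k N W : N <| W -> rcomm k.+1 N W \subset rcomm k N W.
Proof. by move=> /(rcomm_normal k)/normal_norm nKW; rewrite /= commg_subl. Qed.

Lemma rcomm_leq j k N W : N <| W -> j <= k -> rcomm k N W \subset rcomm j N W.
Proof.
move=> nNW /subnK <-; elim: (k - j) => // i IHi.
by rewrite addSn (subset_trans (rcomm_sub _ _)).
Qed.

Lemma rcommD j k N W : rcomm j (rcomm k N W) W = rcomm (j + k) N W.
Proof. by rewrite /rcomm iterD. Qed.

Lemma rcommS k N W : rcomm k [~: N, W]%G W = rcomm k.+1 N W.
Proof. by rewrite /rcomm iterSr. Qed.

Lemma rcommSS k M N W : M \subset N -> rcomm k M W \subset rcomm k N W.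
Proof. by move=> sMN; elim: k => //= k IHk; rewrite commSg. Qed.

(** Contains the discrepancy between (x u)^p and x^p u^p for x in W and u in N, as [hall_power]
    shows. *)
Definition hall_error p N W := ('Mho^1([~: N, W]) <*> rcomm p.-1 N W)%G.

Lemma hall_power p N W x u : prime p -> p.-group W -> N <| W ->
    x \in W -> u \in N ->
  u ^- p * x ^- p * (x * u) ^+ p \in hall_error p N W.
Proof.
move=> p_pr pW nNW Wx Nu; have Wu := subsetP (normal_sub nNW) u Nu.
set L := <<[set x; u]>>; have sLW : L \subset W.
  by rewrite gen_subG; apply/subsetP=> z /set2P[]->.
(* Modulo [N, W] the generators x and u commute, so L' lies in [N, W]; each further commutation adds
   one more W. *)
have sLR i : 'L_i.+2(L) \subset rcomm i.+1 N W.
  elim: i => [|i IHi]; last by rewrite lcnSn commgSS.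
  have [sRW nRW] := andP (rcomm_normal 1 nNW).
  have nRL : L \subset 'N(rcomm 1 N W) := subset_trans sLW nRW.
  have Rux : [~ u, x] \in rcomm 1 N W by apply: mem_commg.
  rewrite lcn2; apply: der1_min => //=; rewrite quotient_gen //; last first.
    by apply: subset_trans nRL; apply: subset_gen.
  have nRl z : z \in L -> z \in 'N(rcomm 1 N W) by apply: subsetP.
  have [Lx Lu] : x \in L /\ u \in L by rewrite !mem_gen ?inE ?eqxx ?orbT.
  have cxu : commute (coset (rcomm 1 N W) x) (coset (rcomm 1 N W) u).
    apply/commute_sym/commgP/eqP; rewrite -morphR ?nRl //.
    exact: coset_id.
  rewrite abelian_gen; apply/centsP => _ /morphimP[y _ y_xu ->].
  move=> _ /morphimP[z _ z_xu ->].
  by case/set2P: y_xu => ->; case/set2P: z_xu => -> //; apply: commute_sym.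
apply: hall_formula => // [z Lz|].
  apply: (subsetP (joing_subl _ _)); rewrite -[p in z ^+ p]expn1.
  apply: (Mho_p_elt 1); first exact: (subsetP (sLR 0)).
  by apply: mem_p_elt pW _; apply: (subsetP (subset_trans (lcn_sub 2 _) sLW)).
apply: subset_trans (joing_subr _ _).
by have := prime_gt1 p_pr; case: p p_pr pW => [|[|q]] // _ _ _; apply: sLR.
Qed.
End HallFormula.

(** * Power subgroups of normal subgroups of p-groups *)

(** Nilpotency makes [A, W] proper in a nontrivial A, and ['Phi(A)], which contains ['Mho^1(A)],
    consists of nongenerators. *)
Lemma nakayama1 (gT : finGroupType) (p : nat) (A W : {group gT}) : p.-group W ->
  A <| W -> A \subset 'Mho^1(A) <*> [~: A, W] -> A :=: 1.
Proof.
move=> pW /andP[sAW nAW] sA; have pA := pgroupS sAW pW.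
apply/eqP/negPn/negP => ntA.
have := @nil_comm_properl _ W A W (pgroup_nil pW) sAW ntA.
rewrite subsetI subxx nAW => /(_ isT) ltRA; have sRA := proper_sub ltRA.
have defA : 'Phi(A) <*> [~: A, W] = A.
  apply/eqP; rewrite eqEsubset join_subG Phi_sub sRA /=.
  apply: subset_trans sA _; rewrite genS // setSU //.
  by rewrite (Phi_joing pA) joing_subr.
by move: ltRA; rewrite -{2}(Phi_nongen defA) genGid properxx.
Qed.

(** Absorbs error terms in ['Mho^1(A)] and [A, W] when A is to be placed in B; this is [nakayama1]
    in the quotient by B. *)
Lemma nakayama (gT : finGroupType) (p : nat) (A B W : {group gT}) :
    p.-group W -> A <| W -> B <| W -> A \subset 'Mho^1(A) <*> [~: A, W] <*> B ->
  A \subset B.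
Proof.
move=> pW nsAW nsBW sA; have [[sAW nAW] nBW] := (andP nsAW, normal_norm nsBW).
have nBA := subset_trans sAW nBW.
have nBM : 'Mho^1(A) \subset 'N(B) := subset_trans (Mho_sub 1 A) nBA.
have nBR : [~: A, W] \subset 'N(B) by rewrite comm_subG.
rewrite -quotient_sub1 //; apply/trivgP.
apply: (nakayama1 (quotient_pgroup B pW) (quotient_normal B nsAW)).
have := quotientS B sA; rewrite quotientYidr ?join_subG ?nBM //.
by rewrite quotientY // quotientR // /quotient morphim_Mho.
Qed.

Section PowerStructure.
Variables (gT : finGroupType) (p : nat) (W : {group gT}).
Hypotheses (p_pr : prime p) (pW : p.-group W).
Implicit Types (A B C N : {group gT}) (X : {set gT}).

Lemma Mho1_normal N : N <| W -> 'Mho^1(N) <| W.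
Proof. exact/char_normal_trans/Mho_char. Qed.

Lemma commW_normal N : N <| W -> [~: N, W] <| W.
Proof. exact: (@rcomm_normal _ 1). Qed.

Lemma commW_sub N : N <| W -> [~: N, W] \subset N.
Proof. exact: (@rcomm_sub _ 0). Qed.

Lemma mem_Mho1 N x : N <| W -> x \in N -> x ^+ p \in 'Mho^1(N).
Proof.
move=> /normal_sub sNW Nx; rewrite -[p in x ^+ p]expn1.
exact: Mho_p_elt (mem_p_elt (pgroupS sNW pW) Nx).
Qed.

(** As the Hall error lies in B, the elements of N with p-th power in B form a subgroup, so
    generators suffice. *)
Lemma Mho1_sub_gen N B X : N <| W -> N \subset <<X>> -> X \subset N ->
    hall_error p N W \subset B -> (forall x, x \in X -> x ^+ p \in B) ->
  'Mho^1(N) \subset B.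
Proof.
move=> nsNW sNX sXN /subsetP sEB XB; have sNW := normal_sub nsNW.
pose S := [set x in N | x ^+ p \in B].
have gS : group_set S.
  apply/group_setP; split=> [|x y]; rewrite !inE ?group1 ?expg1n ?group1 //.
  move=> /andP[Nx Bx] /andP[Ny By]; rewrite groupM //=.
  have := sEB _ (hall_power p_pr pW nsNW (subsetP sNW x Nx) Ny).
  by rewrite groupMl // groupM // groupV.
have sNS : N \subset group gS.
  apply: subset_trans sNX _; rewrite gen_subG; apply/subsetP=> x Xx.
  by rewrite inE (subsetP sXN) //= XB.
rewrite (MhoE _ (pgroupS sNW pW)) gen_subG expn1.
by apply/subsetP=> _ /imsetP[x Nx ->]; have /setIdP[] := subsetP sNS x Nx.
Qed.

Lemma commg_sub_gen N B X : B <| W -> X \subset W -> N \subset <<X>> ->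
  (forall x w, x \in X -> w \in W -> [~ x, w] \in B) -> [~: N, W] \subset B.
Proof.
move=> nsBW sXW sNX XB.
pose S := [set x in W | [forall w in W, [~ x, w] \in B]].
have nBW := normal_norm nsBW.
have gS : group_set S.
  apply/group_setP; split=> [|x y]; rewrite !inE ?group1 /=.
    by apply/forall_inP=> w _; rewrite comm1g group1.
  move=> /andP[Wx /forall_inP Bx] /andP[Wy /forall_inP By]; rewrite groupM //=.
  apply/forall_inP=> w Ww; rewrite commMgJ groupM ?By ?memJ_norm ?Bx //.
  exact: (subsetP nBW).
have sNS : N \subset group gS.
  apply: subset_trans sNX _; rewrite gen_subG; apply/subsetP=> x Xx.
  by rewrite inE (subsetP sXW) //=; apply/forall_inP=> w; apply: XB.
rewrite gen_subG; apply/subsetP=> _ /imset2P[x w Nx Ww ->].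
by have /setIdP[_ /forall_inP->] := subsetP sNS x Nx.
Qed.

Lemma commY_sub A B C : C <| W -> A <| W -> B <| W ->
  [~: A, W] \subset C -> [~: B, W] \subset C -> [~: A <*> B, W] \subset C.
Proof.
move=> nsCW nsAW nsBW sAC sBC.
apply: (@commg_sub_gen (A <*> B)%G _ (A :|: B)) => //.
  by rewrite subUset !normal_sub.
move=> x w /setUP[Ax|Bx] Ww; first by rewrite (subsetP sAC) // mem_commg.
by rewrite (subsetP sBC) // mem_commg.
Qed.

(** Hall's formula for n and [n, w], whose product n^w has p-th power (n^p)^w. *)
Lemma comm_power N n w : N <| W -> n \in N -> w \in W ->
  [~ n, w] ^- p * [~ n ^+ p, w] \in 'Mho^1([~: [~: N, W], W]) <*> rcomm p N W.
Proof.
move=> nsNW Nn Ww; have Wn := subsetP (normal_sub nsNW) n Nn.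
have := hall_power p_pr pW (commW_normal nsNW) Wn (mem_commg Nn Ww).
rewrite /hall_error rcommS prednK ?prime_gt0 //=.
have -> : n * [~ n, w] = n ^ w by rewrite commgEl mulKVg.
by rewrite -conjXg -mulgA -commgEl.
Qed.

Lemma commg_Mho1 N : N <| W ->
  [~: 'Mho^1(N), W] \subset 'Mho^1([~: N, W]) <*> rcomm p N W.
Proof.
move=> nsNW; have sNW := normal_sub nsNW.
have nsRW := commW_normal nsNW.
apply: (@commg_sub_gen _ ('Mho^1([~: N, W]) <*> rcomm p N W)%G
  [set x ^+ p | x in N]).
- by rewrite normalY ?rcomm_normal // Mho1_normal.
- by apply/subsetP=> _ /imsetP[x Nx ->]; rewrite groupX // (subsetP sNW).
- by rewrite /= (MhoE _ (pgroupS sNW pW)) expn1.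
move=> _ w /imsetP[x Nx ->] Ww; rewrite -(mulKVg ([~ x, w] ^+ p) [~ _, _]).
rewrite groupM //.
  by apply: (subsetP (joing_subl _ _)); rewrite mem_Mho1 // mem_commg.
apply: subsetP (comm_power nsNW Nx Ww); rewrite genS // setSU // MhoS //.
exact: commW_sub.
Qed.

Lemma rcomm_trivial N : N <| W -> exists k, rcomm k N W :=: 1.
Proof.
move=> nsNW; have /lcnP[k L1] := pgroup_nil pW; exists k; apply/trivgP.
rewrite -L1; elim: k {L1} => [|k IHk]; first by rewrite lcn1 normal_sub.
by rewrite lcnSn commSg.
Qed.

(** By [comm_power], [n, w]^p lies in B up to p-th powers one step deeper in the series
    [N, W, ..., W]; the descent ends as W is nilpotent. *)
Lemma Mho1_commg N B : N <| W -> B <| W ->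
    [~: 'Mho^1(N), W] \subset B -> rcomm p N W \subset B ->
  'Mho^1([~: N, W]) \subset B.
Proof.
move=> nsNW nsBW sMB sRB.
have step k : 'Mho^1(rcomm k.+1 N W) \subset B <*> 'Mho^1(rcomm k.+2 N W).
  have nsKW := rcomm_normal k nsNW.
  pose B' := (B <*> 'Mho^1(rcomm k.+2 N W))%G.
  have sEB : 'Mho^1(rcomm k.+2 N W) <*> rcomm p (rcomm k N W) W \subset B'.
    rewrite join_subG joing_subr /= (subset_trans _ (joing_subl _ _)) //.
    apply: subset_trans sRB; apply: rcommSS; exact: rcomm_leq (leq0n k).
  apply: (@Mho1_sub_gen _ B' (commg_set (rcomm k N W) W)) => //.
  - exact: commW_normal.
  - exact: subset_gen.
  - by rewrite /hall_error rcommS prednK ?prime_gt0.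
  move=> _ /imset2P[n w Kn Ww ->].
  have := subsetP sEB _ (comm_power nsKW Kn Ww).
  rewrite groupMr ?groupV //; apply: (subsetP (joing_subl _ _)).
  apply: (subsetP sMB); rewrite mem_commg //.
  apply: (subsetP (MhoS 1 (rcomm_leq nsNW (leq0n k)))).
  exact: mem_Mho1.
have [k K1] := rcomm_trivial nsNW.
suff: 'Mho^1([~: N, W]) \subset B <*> 'Mho^1(rcomm k.+1 N W).
  by rewrite /= K1 comm1G Mho1 joingG1.
elim: k {K1} => [|k IHk]; first exact: joing_subr.
by apply: subset_trans IHk _; rewrite join_subG joing_subl step.
Qed.

Lemma hall_error_sub N : N <| W ->
  rcomm p.-1 N W \subset [~: 'Mho^1(N), W] ->
  hall_error p N W \subset [~: 'Mho^1(N), W].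
Proof.
move=> nsNW sR; rewrite join_subG sR andbT.
apply: Mho1_commg => //; first exact/commW_normal/Mho1_normal.
apply: subset_trans (rcomm_leq nsNW _) sR; exact: leq_pred.
Qed.

(** Lets the bound on the Hall error descend the iterated power series. *)
Lemma potent_embedded_Mho1 N : N <| W ->
    rcomm p.-1 N W \subset [~: 'Mho^1(N), W] ->
  rcomm p.-1 ('Mho^1(N))%G W \subset [~: 'Mho^1('Mho^1(N)), W].
Proof.
move=> nsNW CN; set M := 'Mho^1(N)%G; have nsMW : M <| W by apply: Mho1_normal.
have nsRW := commW_normal nsMW.
(* Compares [N^p, W, ..., W] with [N, W, ..., W]^p; each use of [commg_Mho1] brings an error p - 1
   steps below the new term. *)
have sMk k : rcomm k M W \subset 'Mho^1(rcomm k N W) <*> rcomm (p.-1 + k) N W.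
  elim: k => [|k IHk]; first exact: joing_subl.
  have nsKW := rcomm_normal k nsNW; rewrite addnS.
  apply: subset_trans (commSg W IHk) _.
  have nsRW' := rcomm_normal (p.-1 + k) nsNW.
  pose B := ('Mho^1(rcomm k.+1 N W) <*> rcomm (p.-1 + k).+1 N W)%G.
  have nsBW : B <| W.
    by rewrite normalY ?rcomm_normal // Mho1_normal // rcomm_normal.
  apply: (@commY_sub 'Mho^1(rcomm k N W)%G _ B) => //.
  - exact: Mho1_normal.
  - apply: subset_trans (commg_Mho1 nsKW) _.
    by rewrite rcommD -{1}(prednK (prime_gt0 p_pr)) addSn.
  exact: joing_subr.
(* For A the left-hand group, the deep term has 2(p - 1) factors W; [CN] puts it in [M, W, ..., W]
   with p factors, which is [A, W], and Nakayama absorbs it. *)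
have sCM : rcomm p.-1 M W \subset 'Mho^1([~: M, W]).
  apply: (nakayama pW); [exact: rcomm_normal | exact: Mho1_normal |].
  apply: subset_trans (sMk _) _; rewrite join_subG; apply/andP; split.
    by apply: subset_trans (MhoS 1 CN) _; apply: joing_subr.
  apply: subset_trans (joing_subl _ _); apply: subset_trans (joing_subr _ _).
  by rewrite -rcommD (subset_trans (rcommSS _ _ CN)) // rcommS.
(* Now A is ['Mho^1([~: M, W])]; by [sCM] the term [rcomm p M W] left over by [Mho1_commg] lies in
   [A, W]. *)
apply: (subset_trans sCM); apply: (nakayama pW).
- exact: Mho1_normal.
- exact/commW_normal/Mho1_normal.
rewrite -joingA (subset_trans _ (joing_subr _ _)) //.
have nsAW := Mho1_normal nsRW.
pose B := ([~: 'Mho^1([~: M, W]), W] <*> [~: 'Mho^1(M), W])%G.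
apply: (@Mho1_commg _ B) => //.
- by rewrite normalY ?commW_normal // Mho1_normal.
- exact: joing_subr.
rewrite -(prednK (prime_gt0 p_pr)) /=.
by apply: subset_trans (commSg W sCM) (joing_subl _ _).
Qed.

(** With M = ['Mho^1(N)], [M, W] is bounded by squares of [N, W] and by [N, W, W]; the latter
    reduces to squares of [M, W] and to [M, W, W], which Nakayama absorbs. *)
Lemma powerful_embedded_Mho1 N : p = 2 -> N <| W ->
    [~: N, W] \subset 'Mho^1('Mho^1(N)) ->
  [~: 'Mho^1(N), W] \subset 'Mho^1('Mho^1('Mho^1(N))).
Proof.
move=> p2 nsNW sR; have nsMW := Mho1_normal nsNW.
have nsMMW := Mho1_normal nsMW; have nsRW := commW_normal nsMW.
apply: (nakayama pW) => //; first exact: Mho1_normal.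
apply: subset_trans (commg_Mho1 nsNW) _.
rewrite p2 /rcomm /= join_subG; apply/andP; split.
  by apply: subset_trans (MhoS 1 sR) (joing_subr _ _).
apply: subset_trans (joing_subl _ _); apply: subset_trans (commSg W sR) _.
by apply: subset_trans (commg_Mho1 nsMW) _; rewrite p2.
Qed.

End PowerStructure.

(** * The power series of a finite tensor square *)

(* Here tau g h stands for g (x) h, rho for the action of G on the tensor     *)
(* square, and d for the derived map.                                         *)
Section CrossedPairing.
Variables (gT vT : finGroupType) (p : nat) (W : {group vT}).
Variables (rho : {morphism [set: gT] >-> vT}) (tau : gT -> gT -> vT).
Variable d : vT -> gT.
Let T := <<[set tau gh.1 gh.2 | gh : gT * gT]>>%G.
Hypotheses (p_pr : prime p) (pW : p.-group W) (nsTW : T <| W).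
Hypotheses (rhoW : forall x, rho x \in W)
  (actW : forall w, w \in W -> exists x, {in T, forall t, t ^ w = t ^ rho x})
  (tauM : forall g k h, tau (g * k) h = tau g h ^ rho k * tau k h)
  (tauJ : forall g h x, tau g h ^ rho x = tau (g ^ x) (h ^ x))
  (dM : {in T &, {morph d : s t / s * t}})
  (d_tau : forall g h, d (tau g h) = [~ g, h])
  (tau_d : {in T, forall t x, [~ t, rho x] = tau (d t) x}).

Lemma mem_tau g h : tau g h \in T.
Proof. by apply/mem_gen/imsetP; exists (g, h). Qed.

Lemma tau1 h : tau 1 h = 1.
Proof.
apply: (mulgI (tau 1 h)); have := tauM 1 1 h.
by rewrite mul1g morph1 conjg1 mulg1 => <-.
Qed.

(** By [tauM] the map y |-> rho y * tau y h is multiplicative; powers in the first argument thus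
    become powers of a product, ready for Hall's formula. *)
Lemma tauX y h n : tau (y ^+ n) h = rho y ^- n * (rho y * tau y h) ^+ n.
Proof.
elim: n => [|n IHn]; first by rewrite tau1 !expg0 invg1 mulg1.
rewrite expgS tauM IHn morphX ?inE // conjgE !mulgA mulgK.
by rewrite !expgS invMg !mulgA mulgVK.
Qed.

Lemma tau_power (N : {group vT}) y h : N <| W -> tau y h \in N ->
  tau y h ^- p * tau (y ^+ p) h \in hall_error p N W.
Proof.
by move=> nsNW Nt; rewrite tauX mulgA; apply: hall_power => //; apply: rhoW.
Qed.

Definition tau_pow i := <<[set tau (gh.1 ^+ (p ^ i)) gh.2 | gh : gT * gT]>>%G.

Lemma mem_tau_pow i g h : tau (g ^+ (p ^ i)) h \in tau_pow i.
Proof. by apply/mem_gen/imsetP; exists (g, h). Qed.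

Lemma tau_pow_sub i (B : {group vT}) :
  (forall g h, tau (g ^+ (p ^ i)) h \in B) -> tau_pow i \subset B.
Proof.
move=> QB; rewrite gen_subG.
by apply/subsetP=> _ /imsetP[[g h] _ ->]; apply: QB.
Qed.

Lemma tau_pow_normal i : tau_pow i <| W.
Proof.
have sQT : tau_pow i \subset T by apply: tau_pow_sub => g h; apply: mem_tau.
rewrite /normal (subset_trans sQT (normal_sub nsTW)) /= norms_gen //.
apply/subsetP=> w /actW[x Tx]; rewrite inE; apply/subsetP=> _ /imsetP[z Qz ->].
case/imsetP: Qz => -[g h] _ ->; rewrite Tx ?mem_tau // tauJ conjXg.
by apply/imsetP; exists (g ^ x, h ^ x).
Qed.

Fixpoint iterMho i : {group vT} := if i is j.+1 then 'Mho^1(iterMho j)%G else T.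

Lemma iterMho_normal i : iterMho i <| W.
Proof. by elim: i => //= i; apply: Mho1_normal. Qed.

Lemma expg_iterMho i t : t \in T -> t ^+ (p ^ i) \in iterMho i.
Proof.
elim: i => [|i IHi] Tt; first by rewrite expg1.
by rewrite expnSr expgnA (mem_Mho1 pW) ?iterMho_normal ?IHi.
Qed.

(** By induction the elements tau (g^(p^i)) h generate the i-th term; their p-th powers are tau
    (g^(p^(i+1))) h up to the Hall error, which Nakayama absorbs. *)
Lemma iterMhoE :
    (forall i, hall_error p (iterMho i) W
       \subset 'Mho^1(iterMho i.+1) <*> [~: iterMho i.+1, W]) ->
  forall i, iterMho i = tau_pow i.
Proof.
move=> sE; elim=> [|i IHi].
  by apply: val_inj; congr <<_>>; apply: eq_imset => -[g h]; rewrite expg1.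
have nsPW := iterMho_normal; have nsQW := tau_pow_normal.
have XS (g : gT) : g ^+ (p ^ i.+1) = g ^+ (p ^ i) ^+ p by rewrite expnSr expgnA.
have Pt g h : tau (g ^+ (p ^ i)) h \in iterMho i by rewrite IHi mem_tau_pow.
apply/val_inj/eqP; rewrite eqEsubset; apply/andP; split.
  apply: (nakayama pW) => //.
  pose B := ('Mho^1(iterMho i.+1) <*> [~: iterMho i.+1, W] <*> tau_pow i.+1)%G.
  apply: (@Mho1_sub_gen _ _ _ p_pr pW (iterMho i) B
    [set tau (gh.1 ^+ (p ^ i)) gh.2 | gh : gT * gT]) => //.
  - by rewrite [in X in X \subset _]IHi.
  - by apply/subsetP=> _ /imsetP[[g h] _ ->]; apply: Pt.
  - by apply: subset_trans (sE i) (joing_subl _ _).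
  move=> _ /imsetP[[g h] _ ->] /=.
  have := subsetP (sE i) _ (tau_power (nsPW i) (Pt g h)).
  rewrite -XS => /(subsetP (joing_subl _ (tau_pow i.+1)))/groupVr.
  rewrite invMg invgK => Bt.
  rewrite -(mulKVg (tau (g ^+ (p ^ i.+1)) h) (_ ^+ p)).
  by rewrite groupM // (subsetP (joing_subr _ _)) // mem_tau_pow.
apply: tau_pow_sub => g h; rewrite XS.
rewrite -(mulKVg (tau (g ^+ (p ^ i)) h ^+ p) (tau _ h)) groupM //.
  by rewrite (mem_Mho1 pW) ?Pt ?iterMho_normal.
have sEP := subset_trans (sE i) _; apply: (subsetP (sEP _ _)).
  by rewrite join_subG Mho_sub commW_sub.
exact: tau_power.
Qed.

(** * Potency of G carried over to the tensor square *)

Lemma rcomm_sub_T k : rcomm k T W \subset T.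
Proof. exact: (rcomm_leq nsTW (leq0n k)). Qed.

Lemma comm_tauE t w : t \in T -> w \in W -> exists x, [~ t, w] = tau (d t) x.
Proof.
move=> Tt /actW[x Tx]; exists x; rewrite -tau_d //.
by rewrite !commgEl Tx.
Qed.

Lemma d_gen (X : {set vT}) (C : {group gT}) : X \subset T ->
  {in X, forall x, d x \in C} -> {in <<X>>, forall t, d t \in C}.
Proof.
move=> sXT XC t Xt; pose S := [set t in T | d t \in C].
have d1 : d 1 = 1 by apply: (mulgI (d 1)); rewrite -dM ?group1 // !mulg1.
have gS : group_set S.
  apply/group_setP; split=> [|u v]; rewrite !inE ?d1 ?group1 //.
  by move=> /andP[Tu Cu] /andP[Tv Cv]; rewrite groupM // dM // groupM.
have : <<X>> \subset group gS.
  by rewrite gen_subG; apply/subsetP=> x Xx; rewrite inE (subsetP sXT) ?XC.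
by move/subsetP/(_ t Xt); rewrite inE => /andP[].
Qed.

Lemma d_rcomm k : {in rcomm k T W, forall t, d t \in 'L_k.+2([set: gT])}.
Proof.
elim: k => [|k IHk].
  apply: d_gen => [|_ /imsetP[[g h] _ ->]]; first exact: subset_gen.
  by rewrite d_tau mem_commg ?inE.
apply: d_gen => [|_ /imset2P[t w Rt Ww ->]].
  by apply: subset_trans (rcomm_sub_T k.+1); apply: subset_gen.
have [x ->] := comm_tauE (subsetP (rcomm_sub_T k) t Rt) Ww.
by rewrite d_tau mem_commg ?IHk ?inE.
Qed.

Lemma rcomm_tau k : rcomm k.+1 T W
  \subset <<[set tau gh.1 gh.2 | gh in [set u | u.1 \in 'L_k.+2([set: gT])]]>>.
Proof.
rewrite gen_subG; apply/subsetP=> _ /imset2P[t w Rt Ww ->].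
have [x ->] := comm_tauE (subsetP (rcomm_sub_T k) t Rt) Ww.
by apply/mem_gen/imsetP; exists (d t, x); rewrite ?inE ?d_rcomm.
Qed.

(** The g for which every tau g h lies in B form a subgroup, so the generators given by [rcomm_tau]
    need only be tested on X. *)
Lemma rcomm_tau_sub k (B : {group vT}) (X : {set gT}) : B <| W ->
    'L_k.+2([set: gT]) \subset <<X>> ->
    (forall x h, x \in X -> tau x h \in B) ->
  rcomm k.+1 T W \subset B.
Proof.
move=> nsBW sLX XB; pose S := [set g | [forall h, tau g h \in B]].
have gS : group_set S.
  apply/group_setP; split=> [|g k']; rewrite !inE.
    by apply/forallP=> h; rewrite tau1 group1.
  move=> /forallP Bg /forallP Bk; apply/forallP=> h.
  rewrite tauM groupM ?Bk // memJ_norm ?Bg //.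
  exact: (subsetP (normal_norm nsBW)).
have sLS : 'L_k.+2([set: gT]) \subset group gS.
  apply: subset_trans sLX _; rewrite gen_subG; apply/subsetP=> x Xx.
  by rewrite inE; apply/forallP=> h; apply: XB.
apply: subset_trans (rcomm_tau k) _; rewrite gen_subG.
apply/subsetP=> _ /imsetP[[g h] /[!inE] Lg ->] /=.
by have := subsetP sLS g Lg; rewrite inE => /forallP.
Qed.

(** It suffices to place A = [T, W, ..., W], with p - 2 factors W, in ['Mho^1(T)]. By potency A is
    controlled by elements tau (y^p) h, which are p-th powers up to errors in ['Mho^1(T)] or in
    [A, W]. *)
Lemma potent_base : 2 < p ->
    'L_p.-1([set: gT]) \subset power_subgroup p [set: gT] ->
  rcomm p.-1 T W \subset [~: 'Mho^1(T), W].
Proof.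
move=> p3 sLG; have [k def_p] : exists k, p = k.+3.
  by exists (p - 3); rewrite -addn3 subnK.
have pk : p.-1 = k.+2 by rewrite def_p.
suff sET : rcomm k.+1 T W \subset 'Mho^1(T) by rewrite pk; apply: commSg.
have [nsEW nsMW] := (rcomm_normal k.+1 nsTW, Mho1_normal nsTW).
apply: (nakayama pW) => //; pose B := ('Mho^1(T) <*> rcomm k.+2 T W)%G.
have nsBW : B <| W by rewrite normalY // rcomm_normal.
have sB : B \subset
    'Mho^1(rcomm k.+1 T W) <*> [~: rcomm k.+1 T W, W] <*> 'Mho^1(T).
  by rewrite -joingA [_ <*> 'Mho^1(T)]joingC joing_subr.
apply: subset_trans _ sB.
apply: (rcomm_tau_sub nsBW (X := [set x ^+ p | x in [set: gT]])).
  by rewrite -pk.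
move=> _ h /imsetP[y _ ->]; have := tau_power nsTW (mem_tau y h).
move=> Et; rewrite -(mulKVg (tau y h ^+ p) (tau _ h)) groupM //.
  by apply: (subsetP (joing_subl _ _)); rewrite (mem_Mho1 pW) ?mem_tau.
apply: subsetP Et; rewrite /hall_error pk join_subG joing_subr andbT.
by apply: subset_trans (joing_subl _ _); apply/MhoS/commW_sub.
Qed.

(** By potency [T, W] is controlled by elements tau (x^4) h. Squaring twice shows these to be fourth
    powers modulo squares of E and [E, W], which Nakayama absorbs. *)
Lemma powerful_base : p = 2 ->
    [set: gT]^`(1) \subset power_subgroup 4 [set: gT] ->
  [~: T, W] \subset 'Mho^1('Mho^1(T)).
Proof.
move=> p2 sLG; pose E := rcomm 1 T W.
have nsMW := Mho1_normal nsTW; have nsMMW := Mho1_normal nsMW.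
have nsEW : E <| W by apply: rcomm_normal.
apply: (nakayama pW nsEW nsMMW).
pose B := ('Mho^1(E) <*> [~: E, W] <*> 'Mho^1('Mho^1(T)))%G.
have nsBW : B <| W by rewrite !normalY ?Mho1_normal ?commW_normal.
have nBW := subsetP (normal_norm nsBW); have sTW := subsetP (normal_sub nsTW).
have [sMB sRB] : 'Mho^1(E) \subset B /\ [~: E, W] \subset B.
  by apply/andP; rewrite -join_subG joing_subl.
have sMMB : 'Mho^1('Mho^1(T)) \subset B by apply: joing_subr.
have sqrE c : c \in E -> c ^+ 2 \in B.
  by move=> Ec; apply: (subsetP sMB); rewrite -p2 (mem_Mho1 pW).
have Ecomm u x : u \in T -> [~ u, rho x] \in E by move=> Tu; rewrite mem_commg.
have tau2 y h : tau (y ^+ 2) h = tau y h ^+ 2 * [~ tau y h, rho y] ^ tau y h.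
  rewrite expg2 tauM; move: (tau y h) (rho y) => u r.
  by rewrite conjg_mulR; move: [~ u, r] => c; rewrite conjgE expg2 !mulgA mulgK.
apply: (rcomm_tau_sub nsBW (X := [set x ^+ 4 | x in [set: gT]])) => //.
move=> _ h /imsetP[x _ ->]; rewrite (expgnA x 2 2) tau2.
set v := tau _ h; have Tv : v \in T by apply: mem_tau.
(* With c = [v, rho x], the commutator [v, (rho x)^2] is c^2 [c, rho x]. *)
rewrite groupM //; last first.
  rewrite memJ_norm ?nBW ?sTW // morphX ?inE // expg2 commgMJ.
  rewrite (conjg_mulR [~ _, _]) mulgA groupM //.
    by rewrite -expg2 sqrE ?Ecomm.
  by apply: (subsetP sRB); rewrite mem_commg ?Ecomm.
rewrite /v tau2; set u := tau x h; have Tu : u \in T by apply: mem_tau.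
have Ec : [~ u, rho x] ^ u \in E.
  by rewrite memJ_norm ?Ecomm // (subsetP (normal_norm nsEW)) ?sTW.
have Wu2 : u ^+ 2 \in W by rewrite groupX ?sTW.
(* Here v = u^2 c with c in E, so v^2 is u^4 c^2 up to [E, W]. *)
have := hall_power p_pr pW nsEW Wu2 Ec.
set c := _ ^ u in Ec *; rewrite p2 => /(subsetP (_ : _ \subset B)) Bh.
rewrite -(groupMl _ (_ : c ^- 2 * (u ^+ 2) ^- 2 \in B)).
  apply: Bh; rewrite join_subG sRB andbT; apply: subset_trans (Mho_sub _ _) sRB.
rewrite groupM ?groupV //; first exact: sqrE.
apply: (subsetP sMMB).
by rewrite -p2 !(mem_Mho1 pW).
Qed.

(** Induction on i from the base and persistence lemmas, for p > 2 and p = 2 separately, gives the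
    hypothesis of [iterMhoE]; if p^e is the exponent of G, the e-th term is then trivial. *)
Lemma tau_exponent t : potent p [set: gT] -> t \in T ->
  t ^+ exponent [set: gT] = 1.
Proof.
case/andP=> pG potG Tt.
have sE i : hall_error p (iterMho i) W
    \subset 'Mho^1(iterMho i.+1) <*> [~: iterMho i.+1, W].
  have nsPW := iterMho_normal.
  case/orP: potG => /andP[p2 sLG].
    apply: subset_trans (joing_subr _ _); apply: hall_error_sub => //.
    elim: i => [|i IHi]; first exact: potent_base.
    exact: potent_embedded_Mho1.
  move/eqP in p2; apply: subset_trans (joing_subl _ _).
  have sR : [~: iterMho i, W] \subset 'Mho^1(iterMho i.+1).
    elim: i => [|i IHi]; first exact: powerful_base.
    exact: (powerful_embedded_Mho1 p_pr pW p2).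
  rewrite /hall_error p2 join_subG sR andbT.
  exact: subset_trans (Mho_sub _ _) sR.
have /p_natP[e def_e] : p.-nat (exponent [set: gT]) by rewrite pnat_exponent.
have := expg_iterMho e Tt; rewrite def_e (iterMhoE sE).
suff -> : tau_pow e = 1%G by move/set1P.
apply/trivGP/tau_pow_sub => g h; rewrite -def_e expg_exponent ?inE //.
by rewrite tau1.
Qed.

End CrossedPairing.

(** * The non-abelian tensor square *)

Section TensorAlgebra.
Variable gT : finGroupType.
Implicit Types (g h k x y : gT) (s t : tensor_square gT).
Local Notation T := (tensor_square gT).
Local Notation "g \ox h" := (tensor g h) (at level 35).
Local Notation D := (@derived_map gT).

Lemma derivedM : {morph D : s t / s * t}.
Proof. exact: gmulfM. Qed.

Lemma derived1 : D 1 = 1.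
Proof. by apply: (mulgI (D 1)); rewrite -derivedM !mulg1. Qed.

Lemma tensorMl g k h : (g * k) \ox h = ((g ^ k) \ox (h ^ k)) * (k \ox h).
Proof.
rewrite /tensor /pres_gen [RHS]pi_pres_mul.
exact/pi_presentedP/pres_rel/tensor_relL.
Qed.

Lemma tensorMr g h k : g \ox (h * k) = (g \ox k) * ((g ^ k) \ox (h ^ k)).
Proof.
rewrite /tensor /pres_gen [RHS]pi_pres_mul.
exact/pi_presentedP/pres_rel/tensor_relR.
Qed.

Lemma tensor1l h : 1 \ox h = 1.
Proof.
apply: (mulgI (1 \ox h)); have := tensorMl 1 1 h.
by rewrite mul1g !conjg1 mulg1 => <-.
Qed.

Lemma tensorV g h : (g \ox h)^-1 = g^-1 \ox (h ^ g).
Proof.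
apply: (mulIg (g \ox h)); rewrite mulVg.
have := tensorMl g^-1 g h.
by rewrite mulVg tensor1l [_^-1 ^ _]conjgE mulVg mulg1 => ->.
Qed.

Lemma tensor_ind (P : T -> Prop) : P 1 ->
  (forall g h t, P t -> P ((g \ox h) * t)) -> forall t, P t.
Proof.
move=> P1 PM t; elim/quotW: t => w.
elim: w => [|[[g h] b] w IHw]; first exact: P1.
rewrite -cat1s -[X in P X]pi_pres_mul.
case: b; last exact: PM.
have -> : \pi_(presented (@tensor_rel gT))%qT [:: (g, h, true)] = (g \ox h)^-1.
  by rewrite /tensor /pres_gen [RHS]pi_pres_inv.
by rewrite tensorV; apply: PM.
Qed.

Definition tact_fun x (gh : gT * gT) : T := (gh.1 ^ x) \ox (gh.2 ^ x).

Fact tact_rel x u v : tensor_rel u v ->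
  eval_word (tact_fun x) u = eval_word (tact_fun x) v.
Proof.
case=> [g k h|g h k]; rewrite /eval_word !big_cons !big_nil /tact_fun /= !mulg1.
  by rewrite conjMg tensorMl -!conjJg.
by rewrite conjMg tensorMr -!conjJg.
Qed.

Definition tact x : T -> T := pres_lift (tact_fun x).

Lemma tactM x : {morph tact x : s t / s * t}.
Proof. exact: (pres_liftM (@tact_rel x)). Qed.

Lemma tact_tensor x g h : tact x (g \ox h) = (g ^ x) \ox (h ^ x).
Proof. exact: (pres_lift_gen (@tact_rel x)). Qed.

Lemma tact1 x : tact x 1 = 1.
Proof. by apply: (mulgI (tact x 1)); rewrite -tactM !mulg1. Qed.

Lemma tactV x t : tact x t^-1 = (tact x t)^-1.
Proof. by apply: (mulgI (tact x t)); rewrite -tactM !mulgV tact1. Qed.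

Lemma tact_id t : tact 1 t = t.
Proof.
elim/tensor_ind: t => [|g h t IHt]; first exact: tact1.
by rewrite tactM tact_tensor !conjg1 IHt.
Qed.

Lemma tactJ x y t : tact (x * y) t = tact y (tact x t).
Proof.
elim/tensor_ind: t => [|g h t IHt]; first by rewrite !tact1.
by rewrite !tactM !tact_tensor !conjgM IHt.
Qed.

Lemma tensorJ g h t : t ^ (g \ox h) = tact [~ g, h] t.
Proof.
have tJ a b : (a \ox b) ^ (g \ox h) = (a ^ [~ g, h]) \ox (b ^ [~ g, h]).
  (* As g h^g = h g and h g^h = g h, conjugation by the first product takes c, e to a, b, and by the
     second to their [g, h]-conjugates. *)
  pose c := a ^ (h * g)^-1; pose e := b ^ (h * g)^-1.
  have swap (u v : gT) : u * v ^ u = v * u by rewrite conjgE mulVKg.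
  have hgE z : (z ^ (h * g)^-1) ^ (g * h ^ g) = z by rewrite swap conjgKV.
  have ghE z : (z ^ (h * g)^-1) ^ (h * g ^ h) = z ^ [~ g, h].
    by rewrite swap -conjgM; congr (z ^ _); rewrite invMg commgEl conjgE !mulgA.
  have [ca ea] : c ^ (g * h ^ g) = a /\ e ^ (g * h ^ g) = b by rewrite !hgE.
  have [cr er] :
      c ^ (h * g ^ h) = a ^ [~ g, h] /\ e ^ (h * g ^ h) = b ^ [~ g, h].
    by rewrite !ghE.
  clearbody c e; clear swap hgE ghE.
  (* Expand (c g) (x) (e h) in the two possible orders. *)
  have := tensorMl c g (e * h); rewrite conjMg (tensorMr (c ^ g) (e ^ g)).
  rewrite (tensorMr g e h) -!(conjgM _ g (h ^ g)) ca ea.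
  rewrite (tensorMr (c * g) e h) (tensorMl c g h) conjMg.
  rewrite (tensorMl (c ^ h) (g ^ h)) -!(conjgM _ h (g ^ h)) cr er.
  move: (a ^ _ \ox _) (c ^ g \ox _) (g ^ h \ox _) (a \ox b) (g \ox h).
  move=> s u v x y; rewrite -!mulgA => /mulgI; rewrite !mulgA => /mulIg E.
  by rewrite conjgE -E mulKg.
elim/tensor_ind: t => [|a b t IHt]; first by rewrite conj1g tact1.
by rewrite conjMg tJ IHt tactM tact_tensor.
Qed.

(** The Peiffer identity of the crossed module [derived_map]. *)
Lemma conj_tact s t : s ^ t = tact (D t) s.
Proof.
elim/tensor_ind: t s => [|g h t IHt] s.
  by rewrite conjg1 derived1 tact_id.
by rewrite conjgM tensorJ IHt derivedM derived_map_tensor tactJ.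
Qed.

Lemma tensor_derived t x : (D t) \ox x = t^-1 * tact x t.
Proof.
have tE g h : [~ g, h] \ox x = (g \ox h)^-1 * tact x (g \ox h).
  (* Expands [g \ox (h * x)] in two ways, h x being also x^(h^-1) h. *)
  have E1 : (g ^ h) \ox x = (g \ox h)^-1 * ((g \ox x) * tact x (g \ox h)).
    apply: (mulgI (g \ox h)); rewrite mulVKg tact_tensor -tensorMr.
    have -> : h * x = x ^ h^-1 * h by rewrite -conjgCV.
    by rewrite tensorMr conjgKV.
  have E2 : (g^-1 ^ (g ^ h)) \ox (x ^ (g ^ h)) = ((g \ox x) ^ (g \ox h))^-1.
    rewrite tensorJ -tactV tensorV tact_tensor commgEl !(conjgM _ g^-1).
    by rewrite conjgK [g^-1 ^ g^-1]conjgE mulKg.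
  have {1}-> : [~ g, h] = g^-1 * g ^ h by rewrite commgEl.
  by rewrite tensorMl E1 E2 -conjVg conjgE !mulgA !mulgK mulgVK.
elim/tensor_ind: t => [|g h t IHt].
  by rewrite derived1 tensor1l tact1 mulg1 invg1.
rewrite derivedM derived_map_tensor tensorMl -tact_tensor tE IHt.
rewrite -conj_tact conjgE tactM invMg.
by rewrite !mulgA mulgK.
Qed.

End TensorAlgebra.

(** * Finiteness of the tensor square *)

Section Dietzmann.
Variables (G : groupType) (S : seq G) (N : nat).
Hypotheses (N_gt0 : 0 < N) (SN : {in S, forall s, s ^+ N = 1})
  (SJ : {in S &, forall s t, s ^ t \in S}).
Implicit Types (s : G) (w : seq G).

(** A copy of s moves to the front by conjugating the earlier letters by s. Conjugation by s is
    injective and fixes s, so the remaining copies are still counted. *)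
Lemma prod_extract k s w : s \in S -> {subset w <= S} -> k <= count_mem s w ->
  exists w', [/\ {subset w' <= S}, size w = k + size w' &
                 \prod_(x <- w) x = s ^+ k * \prod_(x <- w') x].
Proof.
move=> Ss; elim: k w => [|k IHk] w wS le_k.
  by exists w; split; rewrite // expg0 mul1g.
have ws : s \in w by rewrite -has_pred1 has_count (leq_ltn_trans _ le_k).
case/splitPr: ws wS le_k => w1 w2 wS le_k.
pose w0 := [seq x ^ s | x <- w1] ++ w2.
have w0S : {subset w0 <= S}.
  move=> x; rewrite mem_cat => /orP[/mapP[y w1y ->]|w2x].
    by apply: SJ => //; apply: wS; rewrite mem_cat w1y.
  by rewrite wS // mem_cat inE w2x !orbT.
have sJ : s ^ s = s by rewrite conjgE mulKg.
have count_w0 : k <= count_mem s w0.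
  rewrite count_cat count_map (eq_count (a2 := pred1 s)).
    by move: le_k; rewrite count_cat /= eqxx addnCA add1n ltnS.
  by move=> x /=; rewrite -{2}sJ (inj_eq (@conjg_inj _ s)).
have [w' [w'S sz_w' Ew']] := IHk w0 w0S count_w0.
exists w'; split=> //.
  by move: sz_w'; rewrite !size_cat size_map /= addnS addSn => ->.
rewrite expgS -mulgA -Ew' !big_cat big_cons big_map -conjg_prod /=.
by rewrite mulgA [_ * s]conjgC -mulgA.
Qed.

(** By pigeonhole a longer word contains some letter s at least N times; N copies are extracted, and
    s^N vanishes. *)
Lemma prod_shorten w : {subset w <= S} ->
  exists w', [/\ {subset w' <= S}, size w' <= N * size S &
                 \prod_(x <- w) x = \prod_(x <- w') x].
Proof.
have [n] := ubnP (size w); elim: n w => // n IHn w /ltnSE le_n wS.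
have [le_w|gt_w] := leqP (size w) (N * size S)%N; first by exists w.
have /hasP[s Ss le_s] : has (fun s => N <= count_mem s w) S.
  apply: contraLR gt_w => /hasPn ltN; rewrite -leqNgt.
  have -> : size w = \sum_(x <- w) 1 by rewrite sum1_size.
  apply: (@leq_trans (\sum_(x <- w) \sum_(s <- S) (x == s))).
    rewrite big_seq [leqRHS]big_seq; apply: leq_sum => x /wS Sx.
    by rewrite (big_rem x) //= eqxx.
  rewrite exchange_big /= (@leq_trans (\sum_(s <- S) N)) //.
    rewrite big_seq [leqRHS]big_seq; apply: leq_sum => s Ss.
    have := ltN s Ss; rewrite -ltnNge -sum1_count big_mkcond => /ltnW.
    by apply: leq_trans; apply: leq_sum => x _ /=; case: eqP.
  by rewrite big_const_seq count_predT iter_addn_0.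
have [w' [w'S sz_w ->]] := prod_extract Ss wS le_s.
rewrite SN // mul1g; apply: IHn => //; apply: leq_trans le_n.
by rewrite sz_w -[X in X < _]add0n ltn_add2r.
Qed.

Lemma dietzmann : exists L : seq G,
  forall w, {subset w <= S} -> \prod_(x <- w) x \in L.
Proof.
pose B := fix B n := if n is m.+1 then B m ++ [seq s * x | s <- S, x <- B m]
                     else [:: 1 : G].
have BP n w : size w <= n -> {subset w <= S} -> \prod_(x <- w) x \in B n.
  elim: n w => [|n IHn] [|s w] //= le_n wS; rewrite ?big_nil ?mem_seq1 //.
    by rewrite mem_cat -[1](big_nil 1 *%g xpredT id) IHn.
  rewrite big_cons mem_cat allpairs_f ?orbT ?wS ?mem_head //.
  by rewrite IHn // => x wx; rewrite wS // inE wx orbT.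
exists (B (N * size S)%N) => w /prod_shorten[w' [w'S sz_w' ->]].
exact: BP.
Qed.

End Dietzmann.

Lemma common_torsion (G : groupType) (S : seq G) :
    {in S, forall s, exists2 n, 0 < n & s ^+ n = 1} ->
  exists2 n, 0 < n & {in S, forall s, s ^+ n = 1}.
Proof.
elim: S => [|s S IHS] St; first by exists 1%N.
have [|n n0 Sn] := IHS; first by move=> x Sx; apply: St; rewrite inE Sx orbT.
have [m m0 sm] := St s (mem_head _ _).
exists (m * n)%N; first by rewrite muln_gt0 m0.
move=> x /predU1P[->|Sx]; first by rewrite expgnA sm expg1n.
by rewrite mulnC expgnA Sn // expg1n.
Qed.

Lemma finite_powers_torsion (G : groupType) (L : seq G) x :
  (forall n, x ^+ n \in L) -> exists2 n, 0 < n & x ^+ n = 1.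
Proof.
move=> xL; have /(uniqPn 1)[i [j [lt_ij]]] :
    ~~ uniq [seq x ^+ i | i <- iota 0 (size L).+1].
  apply/negP=> /uniq_leq_size le_sz; have := le_sz L.
  by rewrite size_map size_iota ltnn => /(_ _)/negP[] // _ /mapP[i _ ->].
rewrite size_map size_iota => lt_j.
have lt_i := ltn_trans lt_ij lt_j.
rewrite !(nth_map 0) ?size_iota // !nth_iota // => xE.
exists (j - i); first by rewrite subn_gt0.
by apply: (mulgI (x ^+ i)); rewrite -expgnDr subnKC ?(ltnW lt_ij) // mulg1.
Qed.

Section TensorFinite.
Variable gT : finGroupType.
Local Notation T := (tensor_square gT).
Local Notation "g \ox h" := (tensor g h) (at level 35).
Local Notation D := (@derived_map gT).
Local Notation tprod w := (\prod_(u <- w) (u.1 \ox u.2)).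
Hypothesis nilG : nilpotent [set: gT].

(** Descends the lower central series: the |G|-th power of a tensor is a product of tensors with
    first entry one step further down. P is abstract, as it serves for torsion and, in
    [rgroup_pgroup], for p-elements. *)
Lemma tensor_lcn_ind (P : T -> Prop) :
    (forall x (w : seq (gT * gT)), {in w, forall u, P (u.1 \ox u.2)} ->
       x ^+ #|gT| = tprod w -> P x) ->
  forall g h, P (g \ox h).
Proof.
move=> PX; have [n Ln] := lcnP _ nilG.
suff PL k g h : g \in 'L_(n.+1 - k)([set: gT]) -> P (g \ox h).
  by move=> g h; apply: (PL n); rewrite subSnn lcn1 inE.
elim: k g h => [|k IHk] g h Lg.
  move: Lg; rewrite subn0 Ln => /set1P->.
  by apply: (PX _ [::]) => //; rewrite tensor1l expg1n big_nil.
have LJ a b :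
    a \in 'L_(n.+1 - k)([set: gT]) -> a ^ b \in 'L_(n.+1 - k)([set: gT]).
  by move=> La; rewrite memJ_norm // (subsetP (lcn_norm _ _)) ?inE.
have Lgh : [~ g, h]^-1 \in 'L_(n.+1 - k)([set: gT]).
  rewrite groupV; apply: (subsetP (lcn_sub_leq _ (_ : _ <= (n.+1 - k.+1).+1))).
    by rewrite subSS leq_subLR addnS ltnS -leq_subLR.
  by apply: (subsetP (lcnSnS _ _)); rewrite mem_commg ?inE.
have [w wL wE] : exists2 w : seq (gT * gT),
    {in w, forall u, u.1 \in 'L_(n.+1 - k)([set: gT])} &
    (g \ox h) ^+ #|gT| = (g ^+ #|gT|) \ox h * tprod w.
  (* Raising the exponent from m to m + 1 adds one factor, the conjugate of c^-1 by X. *)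
  elim: #|gT| => [|m [w wL wE]].
    by exists [::] => //; rewrite big_nil !expg0 tensor1l mulg1.
  pose c := [~ g, h] \ox (g ^+ m); pose X := (g ^+ m) \ox h.
  have E : (g ^+ m.+1) \ox h = (g \ox h) * c * X.
    have := tensor_derived (g \ox h) (g ^+ m); rewrite derived_map_tensor => Ec.
    by rewrite /c Ec mulVKg tact_tensor -tensorMl -expgS.
  exists (([~ g, h]^-1 ^ D X, ((g ^+ m) ^ [~ g, h]) ^ D X) :: w).
    by move=> u /predU1P[->|]; [apply: LJ | apply: wL].
  rewrite expgS wE big_cons /= -tact_tensor -tensorV -conj_tact -/c -/X.
  by rewrite E conjgE !mulgA !mulgK.
apply: (PX _ w) => [u /wL Lu|]; first exact: IHk.
rewrite wE; suff -> : g ^+ #|gT| = 1 by rewrite tensor1l mul1g.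
by rewrite -cardsT; apply: expg_cardG; rewrite inE.
Qed.

(** Dietzmann's lemma is applied to the torsion tensors: if x^|G| is a product of them, its powers
    lie in a finite list, so x is torsion. Once all tensors are torsion, the list exhausts the
    group. *)
Lemma tensor_finite : exists L : seq T, forall t, t \in L.
Proof.
pose P t := exists2 n, 0 < n & t ^+ n = 1 :> T.
pose S := [seq u.1 \ox u.2 |
  u <- [seq u <- enum {: gT * gT} | `[< P (u.1 \ox u.2) >]]].
have SP s : s \in S -> P s.
  by case/mapP=> u; rewrite mem_filter => /andP[/asboolP Pu _ ->].
have PS g h : P (g \ox h) -> g \ox h \in S.
  move=> Pgh; apply/mapP; exists (g, h) => //.
  by rewrite mem_filter mem_enum andbT; apply/asboolP.
have SJ : {in S &, forall s t, s ^ t \in S}.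
  move=> _ t /mapP[[g h] + ->] _.
  rewrite mem_filter => /andP[/asboolP[n n0 Pn] _].
  rewrite conj_tact tact_tensor; apply: PS; rewrite -tact_tensor -conj_tact.
  by exists n => //; rewrite -conjXg Pn conj1g.
have [N N0 SN] := common_torsion SP.
have [L LP] := dietzmann N0 SN SJ.
have Pt : forall g h, P (g \ox h).
  apply: tensor_lcn_ind => x w wP xw.
  have [n|n n0 xn] := @finite_powers_torsion _ L (x ^+ #|gT|).
    suff [w' w'S ->] : exists2 w', {subset w' <= S} &
        (x ^+ #|gT|) ^+ n = \prod_(s <- w') s.
      exact: LP.
    elim: n => [|n [w' w'S IHn]]; first by exists [::]; rewrite // big_nil.
    exists ([seq u.1 \ox u.2 | u <- w] ++ w').
      by move=> s; rewrite mem_cat => /orP[/mapP[u wu ->]|/w'S //]; apply/PS/wP.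
    by rewrite expgS IHn big_cat big_map xw.
  exists (#|gT| * n)%N; last by rewrite expgnA.
  by rewrite muln_gt0 n0 -cardsT cardG_gt0.
exists L => t.
suff [w wS ->] : exists2 w, {subset w <= S} & t = \prod_(s <- w) s.
  exact: LP.
elim/tensor_ind: t => [|g h t [w wS ->]].
  by exists [::]; rewrite // big_nil.
exists ((g \ox h) :: w); last by rewrite big_cons.
by move=> s /predU1P[->|/wS //]; apply: PS.
Qed.

End TensorFinite.

(** * The tensor square in its holomorph *)

(* L lists the tensor square, which makes seq_sub L a finite type; the right  *)
(* translations and the action of G generate in Sym(L) an image of the        *)
(* semidirect product of the tensor square by G.                              *)
Section Holomorph.
Variables (gT : finGroupType) (L : seq (tensor_square gT)).
Hypothesis L_all : forall t, t \in L.
Local Notation T := (tensor_square gT).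
Local Notation "g \ox h" := (tensor g h) (at level 35).
Local Notation D := (@derived_map gT).
Implicit Types (g h x : gT) (t u v : T).

Definition enc t : seq_sub L := SeqSub (L_all t).

Fact rtrans_inj t : injective (fun y : seq_sub L => enc (val y * t)).
Proof. by move=> y z /(congr1 val)/mulIg/val_inj. Qed.

Definition rtrans t : {perm seq_sub L} := perm (@rtrans_inj t).

Fact aperm_inj x : injective (fun y : seq_sub L => enc (tact x (val y))).
Proof.
move=> y z /(congr1 val) /= /(congr1 (tact x^-1)).
by rewrite -!tactJ mulgV !tact_id => /val_inj.
Qed.

Definition act_perm x : {perm seq_sub L} := perm (@aperm_inj x).

Lemma rtransM t u : rtrans (t * u) = rtrans t * rtrans u.
Proof. by apply/permP=> y; apply: val_inj; rewrite permM !permE /= mulgA. Qed.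

Lemma rtrans1 : rtrans 1 = 1.
Proof. by apply: (mulgI (rtrans 1)); rewrite -rtransM !mulg1. Qed.

Lemma rtransX t n : rtrans (t ^+ n) = rtrans t ^+ n.
Proof. by elim: n => [|n IHn]; rewrite ?rtrans1 // !expgS rtransM IHn. Qed.

Lemma rtransE t : val (rtrans t (enc 1)) = t.
Proof. by rewrite permE /= mul1g. Qed.

Lemma rtrans_eq t u : rtrans t = rtrans u -> t = u.
Proof. by move=> E; rewrite -[t]rtransE E rtransE. Qed.

Fact act_permM : {in [set: gT] &, {morph act_perm : x y / x * y}}.
Proof.
move=> x y _ _; apply/permP=> z; apply: val_inj.
by rewrite permM !permE /= tactJ.
Qed.
Canonical act_perm_morphism := Morphism act_permM.

Lemma rtransJ t x : rtrans t ^ act_perm x = rtrans (tact x t).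
Proof.
apply: (mulgI (act_perm x)); rewrite -conjgC.
by apply/permP=> y; apply: val_inj; rewrite !permM !permE /= tactM.
Qed.

Lemma rtransJr t u : rtrans t ^ rtrans u = rtrans (tact (D u) t).
Proof.
apply: (mulgI (rtrans u)); rewrite -conjgC -!rtransM -conj_tact.
by rewrite conjgE mulVKg.
Qed.

Definition rtensor g h := rtrans (g \ox h).
Definition rgroup := <<[set rtensor gh.1 gh.2 | gh : gT * gT]>>%G.

Lemma mem_rgroup t : rtrans t \in rgroup.
Proof.
elim/tensor_ind: t => [|g h t IHt]; first by rewrite rtrans1 group1.
by rewrite rtransM groupM //; apply/mem_gen/imsetP; exists (g, h).
Qed.

Lemma rgroupP s : s \in rgroup -> s = rtrans (val (s (enc 1))).
Proof.
pose S := [set s : {perm seq_sub L} | s == rtrans (val (s (enc 1)))].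
have gS : group_set S.
  apply/group_setP; split=> [|a b]; rewrite !inE.
    by rewrite -{2}rtrans1 rtransE rtrans1.
  by move=> /eqP-> /eqP->; rewrite -rtransM rtransE.
suff /subsetP sRS : rgroup \subset group gS.
  by move=> /sRS; rewrite inE => /eqP.
by rewrite gen_subG; apply/subsetP=> _ /imsetP[[g h] _ ->]; rewrite inE rtransE.
Qed.

Definition rderived (s : {perm seq_sub L}) := D (val (s (enc 1))).
Definition hgroup := (rgroup <*> act_perm @* [set: gT])%G.

Lemma act_perm_norm : act_perm @* [set: gT] \subset 'N(rgroup).
Proof.
apply/subsetP=> _ /morphimP[x _ _ ->]; rewrite inE.
apply/subsetP=> _ /imsetP[s /rgroupP-> ->].
by rewrite rtransJ mem_rgroup.
Qed.

Lemma rgroup_normal : rgroup <| hgroup.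
Proof. by rewrite normalYl act_perm_norm. Qed.

Lemma derivedX t n : D (t ^+ n) = D t ^+ n.
Proof. by elim: n => [|n IHn]; rewrite ?derived1 // !expgS derivedM IHn. Qed.

Lemma rtransV t : (rtrans t)^-1 = rtrans t^-1.
Proof. by apply: (mulgI (rtrans t)); rewrite mulgV -rtransM mulgV rtrans1. Qed.

Section Pgroup.
Variable p : nat.
Hypothesis pG : p.-group [set: gT].

(** Conjugation acts through [derived_map], so |G|-th powers are central and the central quotient is
    a p-group. *)
Lemma rgroup_nil : nilpotent rgroup.
Proof.
rewrite -quotient_center_nil; apply: (@pgroup_nil _ p); rewrite -pnat_exponent.
apply: pnat_dvd pG; apply/exponentP=> _ /morphimP[s Ns Rs ->].
rewrite -morphX //; apply: coset_id; rewrite inE groupX //=.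
apply/centP=> u /rgroupP->; rewrite (rgroupP Rs) -rtransX.
apply/commute_sym/commgP; rewrite commgEl rtransJr.
by rewrite derivedX expg_cardG ?inE // tact_id mulVg.
Qed.

(** In a nilpotent group products of p-elements are p-elements, so [tensor_lcn_ind] applies: if
    x^|G| is a p-element, so is x, |G| being a power of p. *)
Lemma rgroup_pgroup : p.-group rgroup.
Proof.
have hallR := nilpotent_pcore_Hall p rgroup_nil.
have memO t : (rtrans t \in 'O_p(rgroup)) = p.-elt (rtrans t).
  by rewrite (mem_normal_Hall hallR) ?pcore_normal ?mem_rgroup.
suff pt g h : p.-elt (rtensor g h).
  apply: pgroupS (pcore_pgroup p rgroup); rewrite gen_subG.
  by apply/subsetP=> _ /imsetP[[g h] _ ->]; rewrite memO pt.
move: g h.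
apply: (@tensor_lcn_ind gT (pgroup_nil pG) (fun t => p.-elt (rtrans t))).
move=> x w wP xE; have : p.-elt (rtrans x ^+ #|gT|).
  rewrite -rtransX xE -memO; elim: w wP {xE} => [|u w IHw] wP.
    by rewrite big_nil rtrans1 group1.
  rewrite big_cons rtransM groupM ?IHw ?memO ?wP ?mem_head // => v wv.
  by rewrite wP // inE wv orbT.
rewrite /p_elt; set m := #[_] => pm.
apply: (@pnat_dvd _ (#|gT| * m)); last by rewrite pnatM pm andbT -cardsT.
by rewrite order_dvdn expgnA expg_order.
Qed.

Lemma hgroup_pgroup : p.-group hgroup.
Proof.
rewrite /pgroup /= norm_joinEr ?act_perm_norm // -/(pgroup _ _) pgroupM.
by rewrite rgroup_pgroup morphim_pgroup.
Qed.

End Pgroup.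
End Holomorph.

Theorem tensor_square_exponent p (gT : finGroupType) (t : tensor_square gT) :
  prime p -> potent p [set: gT] -> t ^+ exponent [set: gT] = 1.
Proof.
move=> p_pr potG; have [pG _] := andP potG.
have [L L_all] := tensor_finite (pgroup_nil pG).
apply: (@rtrans_eq _ _ L_all); rewrite rtransX rtrans1.
apply: (@tau_exponent _ _ p (hgroup L_all) (act_perm_morphism L_all)
  (rtensor L_all) (rderived L_all)) => //.
- exact: hgroup_pgroup.
- exact: rgroup_normal.
- move=> x; apply: (subsetP (joing_subr _ _)).
  by rewrite mem_morphim ?inE.
- move=> w; rewrite /= norm_joinEr ?act_perm_norm // => /mulsgP[s a Rs + ->].
  (* An element of W is a translation s times the action of x, and conjugation by s is the action of
     its derived image. *)
  case/morphimP=> x _ _ ->; exists (rderived L_all s * x).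
  move=> u /rgroupP->; rewrite (rgroupP Rs) conjgM rtransJr !rtransJ.
  by rewrite /rderived rtransE tactJ.
- by move=> g k h; rewrite /= rtransJ -rtransM tact_tensor -tensorMl.
- by move=> g h x; rewrite /= rtransJ tact_tensor.
- move=> u v /rgroupP-> /rgroupP->.
  by rewrite /rderived -rtransM !rtransE derivedM.
- by move=> g h; rewrite /rderived rtransE derived_map_tensor.
- move=> u /rgroupP uE x; rewrite uE commgEl /= rtransJ /rtensor /rderived.
  by rewrite rtransE tensor_derived rtransM rtransV.
exact: mem_rgroup.
Qed.

(** * Central extensions and the Schur multiplier *)

Import GRing.Theory.

Section CentralExtension.
Variables (A : zmodType) (gT : finGroupType) (c : gT -> gT -> A).

Definition cocycle :=
  forall g h k, (c g h + c (g * h)%g k = c h k + c g (h * k)%g)%R.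

Definition cext of cocycle := (A * gT)%type.
Hypothesis cP : cocycle.
Local Notation E := (cext cP).

Lemma cocycle1l g : c 1 g = c 1 1.
Proof. by have := cP 1 1 g; rewrite !mul1g => /addIr. Qed.

Lemma cocycle1r g : c g 1 = c 1 1.
Proof. by have := cP g 1 1; rewrite !mulg1 => /addIr. Qed.

Lemma cocycleV g : c g g^-1 = c g^-1 g.
Proof.
by have := cP g g^-1 g; rewrite mulgV mulVg cocycle1l cocycle1r => /addIr.
Qed.

Definition cext_mul (x y : E) : E := ((x.1 + y.1 + c x.2 y.2)%R, x.2 * y.2).
(** The cocycle is not normalised, so the identity is shifted by c 1 1, as is the embedding
    [cext_in] of A. *)
Definition cext_one : E := ((- c 1%g 1%g)%R, 1).
Definition cext_inv (x : E) : E :=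
  ((- c 1%g 1%g - c x.2^-1%g x.2 - x.1)%R, x.2^-1).

Fact cext_mulA : associative cext_mul.
Proof.
move=> [a g] [b h] [d k]; congr (_, _); rewrite /= ?mulgA //.
by rewrite (addrAC (a + b)%R) -!addrA cP.
Qed.

Fact cext_mul1 : left_id cext_one cext_mul.
Proof.
by case=> a g; congr (_, _); rewrite /= ?mul1g // cocycle1l addrAC addNr add0r.
Qed.

Fact cext_mulr1 : right_id cext_one cext_mul.
Proof.
by case=> a g; congr (_, _); rewrite /= ?mulg1 // cocycle1r subrK.
Qed.

Fact cext_mulV : left_inverse cext_one cext_inv cext_mul.
Proof. by case=> a g; congr (_, _); rewrite /= ?mulVg // !subrK. Qed.

Fact cext_mulrV : right_inverse cext_one cext_inv cext_mul.
Proof.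
case=> a g; congr (_, _); rewrite /= ?mulgV // cocycleV.
by rewrite [(a + _)%R]addrC !subrK.
Qed.

HB.instance Definition _ := Choice.on E.
HB.instance Definition _ := isGroup.Build E
  cext_mulA cext_mul1 cext_mulr1 cext_mulV cext_mulrV.

Definition cext_lift g : E := (0%R, g).
Definition cext_in a : E := ((a - c 1%g 1%g)%R, 1).

Lemma cextM (x y : E) : x * y = ((x.1 + y.1 + c x.2 y.2)%R, x.2 * y.2).
Proof. by []. Qed.

Lemma cext_inD a b : cext_in (a + b)%R = cext_in a * cext_in b.
Proof.
by congr (_, _); rewrite /= ?mul1g // -[RHS]addrA subrK addrAC.
Qed.

Lemma cext_in0 : cext_in 0%R = 1.
Proof. by congr (_, _); rewrite sub0r. Qed.

Lemma cext_inN a : cext_in (- a)%R = (cext_in a)^-1.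
Proof.
by apply: (mulgI (cext_in a)); rewrite -cext_inD subrr cext_in0 mulgV.
Qed.

Lemma cext_inMn a n : cext_in (a *+ n)%R = cext_in a ^+ n.
Proof.
by elim: n => [|n IHn]; rewrite ?mulr0n ?cext_in0 // mulrS cext_inD IHn expgS.
Qed.

Lemma cext_in_inj : injective cext_in.
Proof. by move=> a b [/addIr]. Qed.

Lemma cext_in_central a (x : E) : commute (cext_in a) x.
Proof.
case: x => b g; congr (_, _); rewrite /= ?mul1g ?mulg1 //.
by rewrite cocycle1l cocycle1r [(b + _)%R]addrC.
Qed.

Lemma cext_in_c g h :
  cext_in (c g h) = cext_lift g * cext_lift h * (cext_lift (g * h))^-1.
Proof.
apply: (mulIg (cext_lift (g * h))); rewrite mulgVK !cextM /= mul1g.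
by rewrite cocycle1l !addr0 subrK add0r.
Qed.

Lemma cext_decomp (x : E) : exists a, x = cext_in a * cext_lift x.2.
Proof.
exists x.1; case: x => a g; rewrite cextM /= mul1g addr0.
by rewrite cocycle1l subrK.
Qed.

Lemma cext_comm (x y : E) : [~ x, y] = [~ cext_lift x.2, cext_lift y.2].
Proof.
have cl a (z t : E) : [~ cext_in a * z, t] = [~ z, t].
  rewrite commMg_conj; have /commgP/eqP -> := cext_in_central a t.
  by rewrite conj1g mul1g.
have cr a (z t : E) : [~ z, cext_in a * t] = [~ z, t].
  by rewrite -invgR cl invgR.
have [[a xE] [b yE]] := (cext_decomp x, cext_decomp y).
by rewrite {1}xE {1}yE cl cr.
Qed.

Definition pairing (gh : gT * gT) : E := [~ cext_lift gh.1, cext_lift gh.2].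

(** Commutators in E depend only on images in G, so lifts of products may be replaced by products of
    lifts; the relations become the usual commutator identities. *)
Fact pairing_rel u v : tensor_rel u v ->
  eval_word pairing u = eval_word pairing v.
Proof.
rewrite /eval_word.
case=> [g k h|g h k]; rewrite !big_cons !big_nil /= !mulg1 /pairing /=.
  rewrite -(cext_comm (cext_lift g ^ cext_lift k) (cext_lift h ^ cext_lift k)).
  rewrite -(cext_comm (cext_lift g * cext_lift k) (cext_lift h)).
  by rewrite commMg_conj conjRg.
rewrite -(cext_comm (cext_lift g ^ cext_lift k) (cext_lift h ^ cext_lift k)).
rewrite -(cext_comm (cext_lift g) (cext_lift h * cext_lift k)).
by rewrite commgM_conj conjRg.
Qed.

Definition tensor_cext : tensor_square gT -> E := pres_lift pairing.

Lemma tensor_cextM : {morph tensor_cext : s t / s * t}.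
Proof. exact: (pres_liftM pairing_rel). Qed.

Lemma tensor_cext_tensor g h :
  tensor_cext (tensor g h) = [~ cext_lift g, cext_lift h].
Proof. exact: (pres_lift_gen pairing_rel). Qed.

Lemma tensor_cext1 : tensor_cext 1 = 1.
Proof. by apply: (mulgI (tensor_cext 1)); rewrite -tensor_cextM !mulg1. Qed.

Lemma tensor_cextX t n : tensor_cext (t ^+ n) = tensor_cext t ^+ n.
Proof.
by elim: n => [|n IHn]; rewrite ?tensor_cext1 // !expgS tensor_cextM IHn.
Qed.

Definition cext_word (w : seq (gT * bool)) : E :=
  \prod_(l <- w) (if l.2 then (cext_lift l.1)^-1 else cext_lift l.1).

(* Cancelling a letter against its inverse costs one commutator. *)
Lemma balanced_word w :
    (forall g, count_mem (g, false) w = count_mem (g, true) w) ->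
  exists t, cext_word w = tensor_cext t.
Proof.
have [n] := ubnP (size w); elim: n w => // n IHn [|[g b] w] /ltnSE le_n Ew.
  by exists 1; rewrite /cext_word big_nil tensor_cext1.
have: (g, ~~ b) \in w.
  rewrite -has_pred1 has_count; have := Ew g; case: b {Ew le_n} => /=.
    by rewrite !xpair_eqE eqxx /= add0n => ->.
  by rewrite !xpair_eqE eqxx /= add0n => <-.
move=> wb; case/splitPr: w / wb le_n Ew => w1 w2 le_n Ew.
have [|h|t Et] := IHn (w1 ++ w2).
- by apply: leq_trans le_n; rewrite /= !size_cat addnS /= ltnS.
- have := Ew h; rewrite /= !count_cat /= !xpair_eqE.
  by case: (g == h); case: b {Ew le_n} => /=; lia.
pose l := if b then (cext_lift g)^-1 else cext_lift g.
(* Uses z x z^-1 y = [z^-1, x^-1] x y for the letter z, the word x up to its inverse and the rest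
   y. *)
exists (tensor (l^-1).2 ((cext_word w1)^-1).2 * t).
rewrite tensor_cextM tensor_cext_tensor -cext_comm -Et.
rewrite /cext_word big_cons !big_cat big_cons /=.
rewrite -/(cext_word w1) -/(cext_word w2).
have -> : (if ~~ b then (cext_lift g)^-1 else cext_lift g) = l^-1.
  by rewrite /l; case: (b); rewrite //= invgK.
rewrite -/l; move: (cext_word w1) (cext_word w2) l => x y z.
by rewrite commgEl conjgE !invgK !mulgA mulgVK.
Qed.

End CentralExtension.

(** * Integral chains as signed words *)

Section FreeAbelianWords.
Local Open Scope ring_scope.
Variable X : finType.

Definition chain (l : seq (X * bool)) : {ffun X -> int} :=
  \sum_(u <- l) (if u.2 then - basis u.1 else basis u.1).

Lemma chain_surj (z : {ffun X -> int}) : exists l, z = chain l.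
Proof.
have chD z1 z2 : (exists l, z1 = chain l) -> (exists l, z2 = chain l) ->
    exists l, z1 + z2 = chain l.
  by move=> [l1 ->] [l2 ->]; exists (l1 ++ l2); rewrite /chain big_cat.
have ch0 : exists l, 0 = chain l by exists [::]; rewrite /chain big_nil.
have chMn y n : (exists l, y = chain l) -> exists l, y *+ n = chain l.
  by move=> chy; elim: n => [|n IHn]; rewrite ?mulr0n // mulrS; apply: chD.
have -> : z = \sum_x basis x *~ z x.
  apply/ffunP=> y; rewrite sum_ffunE (bigD1 y) //= big1 => [|x /negPf yx].
    by rewrite ffunMzE ffunE eqxx addr0 intz.
  by rewrite ffunMzE ffunE eq_sym yx mul0rz.
elim/big_ind: _ => // x _; case: (z x) => n.
  by apply: chMn; exists [:: (x, false)]; rewrite /chain big_seq1.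
rewrite NegzE mulrNz -mulNrz; apply: chMn.
by exists [:: (x, true)]; rewrite /chain big_seq1.
Qed.

End FreeAbelianWords.

(** * The universal 2-cocycle and second homology *)

Section SchurExponent.
Variable gT : finGroupType.
Local Open Scope ring_scope.

Definition zero_additive : {additive {ffun gT * gT -> int} -> int} := \0.
(* Against the zero map every chain is a cycle, so this is coker bar3. *)
Definition coker3 := homology (@bar3 gT) zero_additive.
HB.instance Definition _ := GRing.Zmodule.on coker3.

Fact zero_cycle z : z \in is_cycle zero_additive.
Proof. by rewrite inE. Qed.

Definition bclass z : coker3 := (\pi_(coker3) (Cycle (zero_cycle z)))%qT.

Lemma bclassD y z : bclass (y + z) = bclass y + bclass z.
Proof.
rewrite [RHS]pi_homology_add; congr (\pi_(coker3) _)%qT; exact: val_inj.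
Qed.

Lemma bclass_eq y z : bclass y = bclass z <-> exists b, y - z = bar3 b.
Proof. exact: pi_homologyP. Qed.

Lemma bclass0 : bclass 0 = 0.
Proof. by apply: (addrI (bclass 0)); rewrite -bclassD !addr0. Qed.

Lemma bclassN z : bclass (- z) = - bclass z.
Proof. by apply: (addrI (bclass z)); rewrite -bclassD !subrr bclass0. Qed.

Lemma bclassMn z n : bclass (z *+ n) = bclass z *+ n.
Proof.
by elim: n => [|n IHn]; rewrite ?mulr0n ?bclass0 // !mulrS bclassD IHn.
Qed.

Definition bcocycle g h : coker3 := bclass (basis (g, h)).

Lemma bcocycleP : cocycle bcocycle.
Proof.
move=> g h k; rewrite -!bclassD; apply/bclass_eq; exists (- basis (g, h, k)).
rewrite raddfN /= /bar3 ext_basis /=.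
move: (basis (h, k)) (basis ((g * h)%g, k)) (basis (g, (h * k)%g)).
move: (basis (g, h)) => v4 v1 v2 v3.
apply/ffunP=> u; rewrite !ffunE.
by move: (v1 u) (v2 u) (v3 u) (v4 u) => a b c d; lia.
Qed.

Local Notation E := (cext bcocycleP).

(* Spells the element e_g e_h e_(gh)^-1, the image of [g|h] in the extension. *)
Definition boundary_word (u : (gT * gT) * bool) : seq (gT * bool) :=
  let: ((g, h), b) := u in
  if b then [:: (g * h, false); (h, true); (g, true)]%g
  else [:: (g, false); (h, false); (g * h, true)]%g.

Lemma cext_in_chain l :
  cext_in bcocycleP (bclass (chain l))
  = cext_word bcocycleP (flatten [seq boundary_word u | u <- l]).
Proof.
elim: l => [|[[g h] b] l IHl].
  by rewrite /chain /cext_word !big_nil bclass0 cext_in0.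
rewrite /chain /cext_word big_cons /= big_cat /= -/(chain l).
rewrite bclassD cext_inD IHl; congr (_ * _)%g.
have := cext_in_c bcocycleP g h; case: b => /= Egh.
  rewrite !big_cons big_nil /= mulg1 bclassN cext_inN.
  rewrite [X in cext_in _ X]/(bcocycle g h).
  by rewrite Egh !invMg invgK mulgA.
rewrite !big_cons big_nil /= mulg1 [X in cext_in _ X]/(bcocycle g h).
by rewrite Egh mulgA.
Qed.

(** It follows that the word of a cycle is balanced, as [balanced_word] requires. *)
Lemma boundary_count l x :
  bar2 (chain l) x =
  (count_mem (x, false) (flatten [seq boundary_word u | u <- l]))%:Z
  - (count_mem (x, true) (flatten [seq boundary_word u | u <- l]))%:Z.
Proof.
elim: l => [|[[g h] b] l IHl].
  by rewrite /chain big_nil raddf0 ffunE.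
rewrite /chain big_cons /= -/(chain l) raddfD ffunE IHl !count_cat.
have E : bar2 (basis (g, h)) x = (x == h)%:Z - (x == g * h)%g%:Z + (x == g)%:Z.
  by rewrite /bar2 ext_basis /= !ffunE.
move: (count_mem _ _) (count_mem _ _) E => m n E.
case: b => /=; rewrite ?raddfN ?ffunE E !xpair_eqE ![_ == x]eq_sym /=;
  by case: (x == g); case: (x == h); case: (x == (g * h)%g) => /=; lia.
Qed.

(** The class of a cycle in the extension is spelled by a balanced word, so it comes from the tensor
    square and is killed by n. As coker(C_3 -> C_2) embeds in the extension, n times the cycle is a
    boundary. *)
Lemma schur_exponent n (m : schur_multiplier gT) :
  (forall t : tensor_square gT, t ^+ n = 1)%g -> (m ^+ n = 1)%g.
Proof.
move=> Tn; pose H := homology (@bar3 gT) (@bar2 gT).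
pose cl (y : Defs.cycle (@bar2 gT)) : H := (\pi_(H) y)%qT.
elim/quotW: m => z.
have piX k : ((cl z : schur_multiplier gT) ^+ k)%g = cl (z *+ k).
  elim: k => [|k IHk]; first by rewrite mulr0n.
  by rewrite expgS IHk [LHS]pi_homology_add mulrS.
rewrite piX; apply/pi_homologyP.
suff [b bE] : exists b, cycle_val z *+ n = bar3 b.
  by exists b; rewrite -[LHS]raddfB subr0 raddfMn.
have := Defs.cycleP z; rewrite inE; move: (cycle_val z) => y /eqP y0.
have [l yE] := chain_surj y; rewrite {y}yE in y0 *.
have [g|t Et] :=
  @balanced_word _ _ _ bcocycleP (flatten [seq boundary_word u | u <- l]).
  have := boundary_count l g; rewrite y0 ffunE => /esym/eqP.
  by rewrite subr_eq0 => /eqP[].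
have : bclass (chain l *+ n) = bclass 0.
  apply: (@cext_in_inj _ _ _ bcocycleP).
  rewrite bclassMn cext_inMn cext_in_chain Et -tensor_cextX Tn.
  by rewrite tensor_cext1 bclass0 cext_in0.
by move/bclass_eq; rewrite subr0.
Qed.

End SchurExponent.

Local Close Scope group_scope.

Theorem corollary1p2 (p : nat) (gT : finGroupType) :
  prime p -> potent p [set: gT] ->
  gexponent (predT : {pred schur_multiplier gT}) %| p * exponent [set: gT]
  /\ gexponent (mu gT) %| p * exponent [set: gT].
Proof.
move=> p_pr potG; have Tn t := tensor_square_exponent t p_pr potG.
have n0 : 0 < p * exponent [set: gT].
  by rewrite muln_gt0 prime_gt0 ?exponent_gt0.
split; apply/gexponentP => // x _; rewrite mulnC expgnA.
  by rewrite (schur_exponent x Tn) expg1n.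
by rewrite Tn expg1n.
Qed.
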